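(* Consider the setting, assumptions, algorithm and notation described in the context (in particular, $f$ is $L_f$-smooth with $\|\nabla f\|\le G_f$ and $\inf f>-\infty$, $g$ is $L_g$-smooth with $\operatorname{argmin} g\ne\emptyset$, and the stochastic gradients are unbiased with variances bounded by $\sigma_f^2,\sigma_g^2$). Let $a\in(0,1/3)$, let $(x_k)$ be the iterates generated by SDBGD, and let $N_K$ be the random index in $\{0,\dots,K-1\}$ with $\mathbb P(N_K=k)=\eta_k\beta_k/\sum_{k'=0}^{K-1}\eta_{k'}\beta_{k'}$. (1) (Horizon-dependent.) Given a horizon $K\ge1$, run SDBGD with constant parameters $$\eta_k\equiv\eta\propto K^{-a}\in\Big(0,\tfrac{1}{2L_f+4L_g}\Big),\quad \beta_k\equiv\beta\propto\eta^{-3}K^{-1}\in(0,1),\quad \rho_k\equiv\rho\propto\eta^{-2}K^{-2},$$ $$B_{f,k}\equiv B_f\propto\eta^4K^2,\qquad B_{g,k}\equiv B_g\propto\eta^6K^4,$$ where all proportionality constants are independent of $K$. Then $$\mathbb E\big[\|d_{N_K}\|^2\big]\le\mathcal O(K^{-1+2a})\quad\text{and}\quad \mathbb E\big[\|\nabla g(x_{N_K})\|^2\big]\le\mathcal O(K^{-2a}).$$ (2) (Anytime.) Run SDBGD with $$\eta_k\propto(k+1)^{-a}\in\Big(0,\tfrac{1}{2L_f+4L_g}\Big),\quad \beta_k\propto\eta_k^{-3}(k+1)^{-1}\in(0,1),\quad \rho_k\propto\eta_k^{-2}(k+1)^{-2},$$ $$B_{f,k}\propto\eta_k^4(k+1)^2,\qquad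 B_{g,k}\propto\max\big(\eta_k^{-2},\eta_k^6(k+1)^4\big),$$ where all proportionality constants are independent of $k$. Then, for any $K\ge2$, $$\mathbb E\big[\|d_{N_K}\|^2\big]\le\begin{cases}\mathcal O(K^{-2a})&\text{if }0<a<1/4,\\ \mathcal O(K^{2a-1}\log K)&\text{if }1/4\le a<1/3,\end{cases}\qquad \mathbb E\big[\|\nabla g(x_{N_K})\|^2\big]\le\mathcal O(K^{-2a}\log K).$$ In both parts the constants hidden in $\mathcal O(\cdot)$ are independent of $K$.
   Context: Problem and assumptions. $\mathcal H$ is a real Hilbert space with inner product $\langle\cdot,\cdot\rangle$ and norm $\|\cdot\|$. For all $x\in\mathcal H$, $f(x)=\mathbb E_\xi[f_\xi(x)]$ and $g(x)=\mathbb E_\zeta[g_\zeta(x)]$, where $f_\xi,g_\zeta:\mathcal H\to\mathbb R$ are random functions; the expectations are well defined, $f,g$ are differentiable, $\nabla f(x)=\mathbb E_\xi[\nabla f_\xi(x)]$ and $\nabla g(x)=\mathbb E_\zeta[\nabla g_\zeta(x)]$; $\operatorname{argmin} g\neq\emptyset$ and $\inf f>-\infty$. There are constants $L_f,L_g,G_f>0$ and $\sigma_f^2,\sigma_g^2\ge0$ such that: $f$ and $g$ are $L_f$- and $L_g$-smooth (gradients Lipschitz with these constants); $\|\nabla f(x)\|\le G_f$ for all $x$; $\mathbb E_\xi\|\nabla f_\xi(x)-\nabla f(x)\|^2\le\sigma_f^2$ and $\mathbb E_\zeta\|\nabla g_\zeta(x)-\nabla g(x)\|^2\le\sigma_g^2$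 for all $x$. Neither $f$ nor $g$ is assumed convex. Algorithm (SDBGD). Parameters: $\eta_k>0$, $\beta_k>0$, $\rho_k>0$ and integers $B_{f,k},B_{g,k}\ge1$. Start from a deterministic $x_0\in\mathcal H$. At iteration $k$, draw fresh independent samples $\xi_{k,1},\dots,\xi_{k,B_{f,k}}$ (copies of $\xi$) and $\zeta_{k,1},\dots,\zeta_{k,B_{g,k}}$ (copies of $\zeta$), independent of each other and of the past, and set $\nabla f_k=\frac1{B_{f,k}}\sum_i\nabla f_{\xi_{k,i}}(x_k)$, $\nabla g_k=\frac1{B_{g,k}}\sum_j\nabla g_{\zeta_{k,j}}(x_k)$, $\hat\lambda_k=\dfrac{[\beta_k\|\nabla g_k\|^2-\langle\nabla f_k,\nabla g_k\rangle]_+}{\|\nabla g_k\|^2+\rho_k}$, $\hat d_k=\nabla f_k+\hat\lambda_k\nabla g_k$, $x_{k+1}=x_k-\eta_k\hat d_k$, where $[t]_+=\max(t,0)$. Analysis quantities (not computed by the algorithm): $\lambda_k=\dfrac{[\beta_k\|\nabla g(x_k)\|^2-\langle\nabla f(x_k),\nabla g(x_k)\rangle]_+}{\|\nabla g(x_k)\|^2+\rho_k}$ and $d_k=\nabla f(x_k)+\lambda_k\nabla g(x_k)$. The index $N_K$ is drawn independently of the algorithm's samples, and $\mathbb E$ is the total expectation over the samples and $N_K$. Convention on $\propto$: for the real parameters, $u\propto v$ means $u=c\,v$ with a fixed constant $c>0$ (independent of $K$, resp. $k$). For the batch sizes, which are integers $\ge1$, it means $c\,v\le B\le C\,v$ with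 fixed constants $0<c\le C$ (independent of $K$, resp. $k$). The constants are such that the range constraints on $\eta$ (resp. $\eta_k$) and $\beta$ (resp. $\beta_k$) hold for all $K$ (resp. $k$). *)

(* Defs.v *)
From HB Require Import structures.
From mathcomp Require Import all_boot all_order all_algebra.
From mathcomp Require Import all_classical all_reals all_analysis.

Set Implicit Arguments.
Unset Strict Implicit.
Unset Printing Implicit Defensive.

Import Order.TTheory GRing.Theory Num.Theory.
Import numFieldNormedType.Exports.

Local Open Scope classical_set_scope.
Local Open Scope ring_scope.

(** A real Hilbert space is a complete normed space
    [H : completeNormedModType R] whose norm is induced by a positive definite
    symmetric bilinear form [ip : {dot H for idfun}]. *)
Definition hilbert_norm (R : realType) (H : completeNormedModType R)
    (ip : {dot H for idfun}) : Prop :=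
  forall x : H, `|x| ^+ 2 = ip x x.

(** [u] is the gradient of [phi] at [x]: the Frechet derivative of [phi] at [x]
    is the inner product with [u]. *)
Definition is_gradient (R : realType) (H : completeNormedModType R)
    (ip : {dot H for idfun}) (phi : H -> R) (x u : H) : Prop :=
  is_diff x (phi : H -> R^o) (ip u).

Section VectorValuedExpectation.
Context {R : realType} {H : completeNormedModType R}.
Context {d : measure_display} {T : measurableType d}.

(* A list [:: (A_1, v_1); ...; (A_n, v_n)] with measurable A_i encodes the
   simple function  sum_i 1_{A_i} v_i; the A_i may overlap. *)
Definition measurable_blocks (s : seq (set T * H)) : Prop :=
  forall p, p \in s -> measurable p.1.

Definition simple_fct (s : seq (set T * H)) (t : T) : H :=
  \sum_(p <- s) (\1_(p.1) t : R) *: p.2.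

Definition simple_expectation (P : probability T R) (s : seq (set T * H)) : H :=
  \sum_(p <- s) fine (P p.1) *: p.2.

Definition strongly_measurable (X : T -> H) : Prop :=
  exists2 s : nat -> seq (set T * H),
    forall n, measurable_blocks (s n) &
    forall t, simple_fct (s n) t @[n --> \oo] --> X t.

(** [m] is the (Bochner) expectation of the random vector [X]. *)
Definition has_expectation (P : probability T R) (X : T -> H) (m : H) : Prop :=
  strongly_measurable X /\
  exists s : nat -> seq (set T * H),
    [/\ forall n, measurable_blocks (s n),
        (\int[P]_t (`|X t - simple_fct (s n) t|)%:E)%E @[n --> \oo] --> 0%E &
        simple_expectation P (s n) @[n --> \oo] --> m].

End VectorValuedExpectation.

(** Joint measurability of a random map [G : S -> H -> H], i.e., what makes
    [G (xi w) (X w)] a random vector whenever [xi] is a random element of [S] and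
    [X] a random vector.  For separable [H] this is Borel measurability of
    [(s, x) |-> G s x] on the product; it is stated through strongly measurable
    [X] because in a nonseparable [H] the identity is not strongly measurable.
    Random maps that are strongly measurable in [s] and continuous in [x]
    satisfy it. *)
Definition jointly_measurable (R : realType) (H : completeNormedModType R)
    (dS : measure_display) (S : measurableType dS) (G : S -> H -> H) : Prop :=
  forall (d : measure_display) (T : measurableType d) (X : T -> H),
    strongly_measurable X ->
    strongly_measurable (fun p : S * T => G p.1 (X p.2)).

(** The assumptions shared by the two objectives.  [PS] is the law of the random
    parameter, [Phi s] the random function and [gradPhi s] its gradient; [phi] is
    the objective, [gradphi] its gradient, [L] its smoothness constant and
    [sigma2] the variance bound. *)
Record stochastic_objective (R : realType) (H : completeNormedModType R)
    (ip : {dot H for idfun}) (dS : measure_display) (S : measurableType dS)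
    (PS : probability S R) (Phi : S -> H -> R) (gradPhi : S -> H -> H)
    (phi : H -> R) (gradphi : H -> H) (L sigma2 : R) : Prop := {
  objective_integrable : forall x,
    PS.-integrable setT (fun s => (Phi s x)%:E) ;
  objectiveE : forall x, ('E_PS[fun s => Phi s x] = (phi x)%:E)%E ;
  (* almost surely in s, so that gradPhi s x is arbitrary where Phi s is not
     differentiable *)
  sample_gradient : forall x,
    {ae PS, forall s, is_gradient ip (Phi s) x (gradPhi s x)} ;
  sample_gradient_measurable : jointly_measurable gradPhi ;
  objective_gradient : forall x, is_gradient ip phi x (gradphi x) ;
  gradient_unbiased : forall x,
    has_expectation PS (fun s => gradPhi s x) (gradphi x) ;
  gradient_lipschitz : L.-lipschitz gradphi ;
  gradient_variance : forall x,
    ('E_PS[fun s => (`|gradPhi s x - gradphi x| ^+ 2)%R] <= sigma2%:E)%E }.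

Section Algorithm.
Context {R : realType} {H : completeNormedModType R}.
Variable ip : {dot H for idfun}.

(* Arguments u, v: (an estimate of) the gradient of f, resp. of g. *)
Definition multiplier (beta rho : R) (u v : H) : R :=
  Num.max (beta * `|v| ^+ 2 - ip u v) 0 / (`|v| ^+ 2 + rho).

Definition direction (beta rho : R) (u v : H) : H :=
  u + multiplier beta rho u v *: v.

Definition minibatch (S : Type) (G : S -> H -> H) (B : nat) (s : nat -> S)
    (x : H) : H :=
  B%:R^-1 *: \sum_(i < B) G (s i) x.

(** The iterate x_k on given realizations [s k i], [z k j] of the samples drawn
    at iteration [k]. *)
Fixpoint sdbgd (Sf Sg : Type) (gradF : Sf -> H -> H) (gradG : Sg -> H -> H)
    (eta beta rho : nat -> R) (Bf Bg : nat -> nat) (x0 : H)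
    (s : nat -> nat -> Sf) (z : nat -> nat -> Sg) (k : nat) : H :=
  if k is k'.+1 then
    let x := sdbgd gradF gradG eta beta rho Bf Bg x0 s z k' in
    x - eta k' *: direction (beta k') (rho k')
                    (minibatch gradF (Bf k') (s k') x)
                    (minibatch gradG (Bg k') (z k') x)
  else x0.

End Algorithm.

(** Mutual independence of the families of events [F i], for [i] in [D]. *)
Definition mutually_independent (R : realType) (d : measure_display)
    (T : measurableType d) (P : probability T R) (I : eqType) (D : set I)
    (F : I -> set (set T)) : Prop :=
  forall (J : seq I) (E : I -> set T), uniq J ->
    (forall i, i \in J -> D i /\ F i (E i)) ->
    (P (\bigcap_(i in [set i | i \in J]) E i) = \prod_(i <- J) P (E i))%E.

(* inl (inl (k, i)): the sample xi_{k,i}; inl (inr (k, j)): the sample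
   zeta_{k,j}; inr tt: the random output index.  Batches are indexed from 0. *)
Definition draw : Type := (nat * nat + nat * nat + unit)%type.

Definition drawn (Bf Bg : nat -> nat) : set draw :=
  [set i | match i with
           | inl (inl (k, i)) => (i < Bf k)%N
           | inl (inr (k, j)) => (j < Bg k)%N
           | inr _ => true
           end].

Section Sampling.
Context {R : realType} {dO df dg : measure_display}.
Context {Omega : measurableType dO} {Sf : measurableType df}
  {Sg : measurableType dg}.
Variables (P : probability Omega R) (Pf : probability Sf R)
  (Pg : probability Sg R).

Definition draw_events (xi : nat -> nat -> {mfun Omega >-> Sf})
    (zeta : nat -> nat -> {mfun Omega >-> Sg}) (N : {mfun Omega >-> nat})
    (i : draw) : set (set Omega) :=
  match i with
  | inl (inl (k, i)) => g_sigma_algebra_preimage (xi k i)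
  | inl (inr (k, j)) => g_sigma_algebra_preimage (zeta k j)
  | inr _ => g_sigma_algebra_preimage N
  end.

(** [xi k i], [i < Bf k], are copies of xi, [zeta k j], [j < Bg k], are copies of
    zeta, [N] takes the value [k < K] with probability proportional to [w k], and
    all of these are mutually independent. *)
Definition sampling (Bf Bg : nat -> nat) (w : nat -> R) (K : nat)
    (xi : nat -> nat -> {mfun Omega >-> Sf})
    (zeta : nat -> nat -> {mfun Omega >-> Sg})
    (N : {mfun Omega >-> nat}) : Prop :=
  [/\ forall k i A, (i < Bf k)%N -> measurable A -> P (xi k i @^-1` A) = Pf A,
      forall k j A, (j < Bg k)%N -> measurable A -> P (zeta k j @^-1` A) = Pg A,
      forall k, (k < K)%N ->
        P (N @^-1` [set k]) = (w k / \sum_(0 <= l < K) w l)%:E &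
      mutually_independent P (drawn Bf Bg) (draw_events xi zeta N)].

End Sampling.

Definition propto (R : realType) (D : set nat) (u v : nat -> R) : Prop :=
  exists2 c, 0 < c & forall k, D k -> u k = c * v k.

Definition batch_propto (R : realType) (D : set nat) (B : nat -> nat)
    (v : nat -> R) : Prop :=
  exists c C, [/\ 0 < c, c <= C & forall k, D k ->
    (1 <= B k)%N /\ c * v k <= (B k)%:R <= C * v k].

(* Main.v *)
Require Import Defs.
From HB Require Import structures.
From mathcomp Require Import all_boot all_order all_algebra.
From mathcomp Require Import all_classical all_reals all_analysis.
From mathcomp Require Import measurable_realfun ring lra.

Set Implicit Arguments.
Unset Strict Implicit.
Unset Printing Implicit Defensive.

Import Order.TTheory GRing.Theory Num.Theory.
Import numFieldNormedType.Exports.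

Local Open Scope classical_set_scope.
Local Open Scope ring_scope.

(** Every estimate is pathwise in the sampling errors [e_f = u_k - grad f (x_k)]
    and [e_g = v_k - grad g (x_k)] of the minibatch gradients.  By smoothness,
    [f] decreases by [eta |d|^2 / 2] up to terms in [beta |v|] and [|e_f|^2], and
    the Lyapunov function [g + 2 Lg eta f] decreases by [eta beta |v|^2 / 4] up to
    terms of order [1/k], [eta |e_f|^2] and [|e_g|^2].  Summing with nonincreasing
    weights bounds the sums of [eta beta |grad g|^2] and of [eta beta |d|^2]; the
    direction is Lipschitz in [v] with constant of order [beta + rho^(-1/2)], which
    turns the computed direction into the exact one.  The bounds being affine in
    [|e_f|^2] and [|e_g|^2], only the minibatch variances [sigma^2 / B] enter the
    expectation.  They follow from the independence of each sample from the
    sigma-algebra of the earlier draws, by Fubini, since the sample errors are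
    then orthogonal martingale increments. *)

(** * One step of the algorithm *)

(** With the clock [n] (the horizon, or k + 1) and [p = n^a], the schedules read eta ~ 1/p, beta ~
    p^3/n and sqrt rho ~ p/n. These exponents make eta sqrt rho and eta^3 beta both of order 1/n,
    the price of one step for the Lyapunov function, and the batch sizes bring the noise down to
    that order. The weights eta beta ~ p^2/n add up to at least a multiple of K^(2a), which gives
    the rate of |grad g|^2. The direction is harder. Telescoping f with weights beta leaves a term
    in eta beta^2 |v|, and Young's inequality charges it to eta beta |v|^2 with the factor beta/eta
    ~ p^4/n = n^(4a - 1). The Lyapunov decrease is thus summed a second time, with weights above
    p^4/n, while telescoping demands nonincreasing weights. For 4a < 1 the ratio p^4/n itself
    qualifies and the sum of n^(4a - 2) converges. For 4a >= 1 it increases and is replaced by the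
    constant K^(4a - 1), and the harmonic sum that remains is the source of the logarithm. With
    constant parameters the weights are constant and no logarithm appears. *)

Section Hilbert.
Variables (R : realType) (H : completeNormedModType R).
Variables (ip : {dot H for idfun}).
Hypothesis hip : hilbert_norm ip.
Implicit Types (x y z u v : H) (a : R).

Lemma ipC x y : ip x y = ip y x.
Proof. by rewrite hermC expr0 mul1r. Qed.

Lemma ipDl x y z : ip (x + y) z = ip x z + ip y z.
Proof. exact: linearDl. Qed.

Lemma ipNl x z : ip (- x) z = - ip x z.
Proof. exact: linearNl. Qed.

Lemma ipZl a x z : ip (a *: x) z = a * ip x z.
Proof. exact: linearZl_LR. Qed.

Lemma ipDr x y z : ip z (x + y) = ip z x + ip z y.
Proof. by rewrite ipC ipDl !(ipC z). Qed.

Lemma ipNr x z : ip z (- x) = - ip z x.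
Proof. by rewrite ipC ipNl ipC. Qed.

Lemma ipZr a x z : ip z (a *: x) = a * ip z x.
Proof. by rewrite ipC ipZl ipC. Qed.

Definition ipE := (ipDl, ipNl, ipZl, ipDr, ipNr, ipZr).

Lemma ip0l x : ip 0 x = 0.
Proof. by have := ipZl 0 0 x; rewrite scale0r mul0r. Qed.

(* The triangle inequality holds for the norm of [H], so it yields
   Cauchy-Schwarz by expansion of [`|x + y| ^+ 2]. *)
Lemma ip_le_norm x y : ip x y <= `|x| * `|y|.
Proof.
have := ler_normD x y.
rewrite -(ler_pXn2r (n := 2) _ (normr_ge0 (x + y))) ?nnegrE ?addr_ge0//.
rewrite hip sqrrD !hip !ipE (ipC y x); lra.
Qed.

Lemma ip_ge_norm x y : - (`|x| * `|y|) <= ip x y.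
Proof. by have := ip_le_norm (- x) y; rewrite ipNl normrN; lra. Qed.

Lemma normr_ip_le x y : `|ip x y| <= `|x| * `|y|.
Proof. by rewrite ler_norml ip_ge_norm ip_le_norm. Qed.

(** The gap [D] between [phi] along the segment and its quadratic model has a nonpositive
    derivative, by Cauchy-Schwarz and the Lipschitz bound on the gradient. The mean value theorem
    then gives D 1 <= D 0 without any integral. *)
Lemma smooth_upper_bound (phi : H -> R) (gradphi : H -> H) (L : R) :
  (forall x, is_gradient ip phi x (gradphi x)) -> L.-lipschitz gradphi ->
  forall x y,
    phi y <= phi x + ip (gradphi x) (y - x) + L / 2 * `|y - x| ^+ 2.
Proof.
move=> dphi lip x y; set h := y - x.
pose line t : H := x + t *: h.
pose D t : R := phi (line t) - t * ip (gradphi x) h - L / 2 * t ^+ 2 * `|h| ^+ 2.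
pose dD t := ip (gradphi (line t)) h - ip (gradphi x) h - L * t * `|h| ^+ 2.
have dpl (t : R) : is_derive t 1 (phi \o line : R -> R^o) (ip (gradphi (line t)) h).
  have dl : is_diff t line ( *:%R^~ h).
    apply: (@is_diff_eq _ _ _ (cst x + ( *:%R^~ h)) (cst 0 + ( *:%R^~ h))).
    by apply/funext => s /=; rewrite add0r.
  have dc : is_diff t (phi \o line : R -> R^o) (ip (gradphi (line t)) \o ( *:%R^~ h)).
    by apply: is_diff_comp; exact: dphi.
  apply: DeriveDef; first exact/derivable1_diffP/ex_diff.
  by rewrite deriveE ?diff_val/= ?scale1r//; exact: ex_diff.
have dDP (t : R) : is_derive t 1 (D : R -> R^o) (dD t).
  (* The quadratic model is written as a polynomial in the line parameter so that its derivative is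
     computed formally. *)
  pose p : {poly R} := ip (gradphi x) h *: 'X + (L / 2 * `|h| ^+ 2) *: 'X^2.
  have -> : D = (fun s => phi (line s) - p.[s]).
    by apply/funext => s; rewrite /D /p hornerD !hornerZ hornerX hornerXn; ring.
  have -> : dD t = ip (gradphi (line t)) h - p^`().[t].
    by rewrite /dD /p derivD !derivZ derivX derivXn hornerD !hornerZ hornerC hornerMn hornerX -mulr_natr; field.
  exact: (is_deriveB (dpl t) (is_derive_poly p t)).
have Dc : {within `[0, 1], continuous (D : R -> R^o)}.
  apply: derivable_within_continuous => t _.
  exact: (@ex_derive _ _ _ _ _ _ _ (dDP t)).
have [c c01 DE] := @MVT R D dD 0 1 ltr01 (fun t _ => dDP t) Dc.
have c0 : 0 <= c by move: c01; rewrite in_itv/= => /andP[/ltW].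
have lipc : `|gradphi (line c) - gradphi x| <= L * (c * `|h|).
  have := lip (line c, x) (conj I I); rewrite /= /line addrAC subrr add0r normrZ.
  by rewrite (ger0_norm c0).
have : dD c <= 0.
  rewrite /dD -ipNl -ipDl.
  have := ip_le_norm (gradphi (line c) - gradphi x) h.
  have := ler_wpM2r (normr_ge0 h) lipc; nra.
move: DE; rewrite subr0 mulr1 /D /line scale1r scale0r addr0.
have -> : x + h = y by rewrite /h addrC subrK.
lra.
Qed.

(** * The multiplier and the direction for given gradient estimates *)

Section OneStep.
Variables (beta rho : R) (u v : H).
Hypotheses (beta_ge0 : 0 <= beta) (rho_gt0 : 0 < rho).
Let lam := multiplier ip beta rho u v.
Let d := direction ip beta rho u v.

Let den_gt0 : 0 < `|v| ^+ 2 + rho.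
Proof. by rewrite ltr_wpDl ?exprn_ge0. Qed.

Lemma multiplier_ge0 : 0 <= lam.
Proof. by rewrite /lam /multiplier divr_ge0 ?(ltW den_gt0)// le_max lexx orbT. Qed.

Let lamE : lam * (`|v| ^+ 2 + rho) = Num.max (beta * `|v| ^+ 2 - ip u v) 0.
Proof. by rewrite /lam /multiplier mulfVK // gt_eqF. Qed.

Let ip_vd : ip v d = ip u v + lam * `|v| ^+ 2.
Proof. by rewrite /d /direction ipDr ipZr hip (ipC v). Qed.

(** Complementary slackness: either [lam] vanishes, or ip v d = beta |v|^2 - lam rho, and the
    regularization only lowers this value. *)
Lemma multiplier_ip_direction : lam * ip v d <= lam * (beta * `|v| ^+ 2).
Proof.
have l0 := multiplier_ge0; move: lamE; rewrite ip_vd maxEle.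
case: ifPn => [_ /eqP|_ lE].
  by rewrite mulf_eq0 (gt_eqF den_gt0) orbF => /eqP ->; rewrite !mul0r.
have := mulr_ge0 (mulr_ge0 l0 l0) (ltW rho_gt0).
have : lam * (lam * (`|v| ^+ 2 + rho)) = lam * (beta * `|v| ^+ 2 - ip u v).
  by rewrite lE.
lra.
Qed.

(** Approximate feasibility of [d] for the constraint ip v d >= beta |v|^2. The defect [lam * rho]
    is the price of the regularization, and [multiplier_rho_le] shows that it is of order sqrt
    rho. *)
Lemma barrier_ip_direction : beta * `|v| ^+ 2 - lam * rho <= ip v d.
Proof.
have : beta * `|v| ^+ 2 - ip u v <= lam * (`|v| ^+ 2 + rho).
  by rewrite lamE le_max lexx.
rewrite ip_vd; lra.
Qed.

Lemma multiplier_den_le :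
  lam * (`|v| ^+ 2 + rho) <= beta * `|v| ^+ 2 + `|u| * `|v|.
Proof.
rewrite lamE ge_max addr_ge0 ?mulr_ge0 ?exprn_ge0// andbT lerD2l.
by have := ip_ge_norm u v; lra.
Qed.

Lemma multiplier_norm_le :
  lam * `|v| ^+ 2 <= beta * `|v| ^+ 2 + `|u| * `|v|.
Proof.
apply: le_trans multiplier_den_le.
by rewrite ler_wpM2l ?multiplier_ge0 // lerDl ltW.
Qed.

(** By 2 r |v| <= |v|^2 + r^2, the multiplier is at most beta + |u| / (2 r). It may blow up like
    1/r, but its product with rho = r^2 is still of order r. *)
Lemma multiplier_rho_le (r : R) : 0 < r -> rho = r ^+ 2 ->
  lam * rho <= beta * rho + `|u| * r / 2.
Proof.
move=> r0 rhoE.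
suff : lam <= beta + `|u| / (2 * r).
  move=> /(ler_wpM2r (ltW rho_gt0)); rewrite mulrDl rhoE.
  suff -> : `|u| / (2 * r) * r ^+ 2 = `|u| * r / 2 by [].
  by field; rewrite gt_eqF.
rewrite -(ler_pM2r den_gt0); apply: le_trans multiplier_den_le _.
rewrite mulrDl; apply: lerD.
  by rewrite ler_wpM2l // lerDl ltW.
rewrite -mulrA ler_wpM2l // rhoE -(ler_pM2l (_ : 0 < 2 * r)) ?mulr_gt0//.
rewrite mulrA divff ?mulf_neq0 ?gt_eqF// mul1r.
have : 0 <= (`|v| - r) ^+ 2 by rewrite sqr_ge0.
rewrite sqrrB; lra.
Qed.

End OneStep.

(** Since u = d - lam v, ip u d is |d|^2 minus lam (ip v d), and slackness bounds the latter by beta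
    times lam |v|^2. Of the decrease eta |d|^2, the gradient error takes a quarter and the curvature
    term another quarter, by eta Lf <= 1/2; half remains. *)
Lemma descent_upper (phi : H -> R) (gradphi : H -> H) (Lf G eta beta rho : R)
    (x u v : H) :
  (forall x, is_gradient ip phi x (gradphi x)) -> Lf.-lipschitz gradphi ->
  (forall x, `|gradphi x| <= G) -> 0 < eta -> eta * Lf <= 1 / 2 ->
  0 <= beta -> 0 < rho ->
  let d := direction ip beta rho u v in
  phi (x - eta *: d) + eta * `|d| ^+ 2 / 2 <=
  phi x + eta * (2 * `|u - gradphi x| ^+ 2 + 5 / 4 * beta ^+ 2 * `|v| ^+ 2
                 + beta * G * `|v|).
Proof.
move=> dphi lip Gb eta0 etaL beta0 rho0; rewrite /=; set d := direction _ _ _ _ _; set e := u - gradphi x.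
have := smooth_upper_bound dphi lip x (x - eta *: d).
have -> : x - eta *: d - x = - (eta *: d) by rewrite addrAC subrr add0r.
rewrite normrN normrZ (gtr0_norm eta0) ipNr ipZr.
have -> : gradphi x = u - e by rewrite /e opprB addrC subrK.
rewrite ipDl ipNl.
have ud : `|d| ^+ 2 - multiplier ip beta rho u v * ip v d = ip u d.
  have -> : u = d - multiplier ip beta rho u v *: v by rewrite /d /direction addrK.
  by rewrite ipDl ipNl ipZl -hip {1}/d /direction addrK.
have h1 := multiplier_ip_direction beta u v rho0.
have h2 := multiplier_norm_le u v beta0 rho0.
have h3 := multiplier_ge0 beta u v rho0.
have h4 := ip_le_norm e d.
have h5 : `|u| <= G + `|e|.
  by rewrite -(subrK (gradphi x) u) -/e addrC (le_trans (ler_normD _ _)) ?lerD2r.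
move: ud h1 h2 h3 h4 h5.
rewrite -/d; move: (multiplier ip beta rho u v) (ip v d) (ip u d) (ip e d) => l a b c.
move: (normr_ge0 d) (normr_ge0 e) (normr_ge0 v) (normr_ge0 u).
move: `|d| `|e| `|v| `|u| => D E V U D0 E0 V0 U0 <- h1 h2 h3 h4 h5 hsm.
have k1 : E * D <= D ^+ 2 / 4 + E ^+ 2.
  by have := sqr_ge0 (D / 2 - E); lra.
have k2 : beta * E * V <= beta ^+ 2 * V ^+ 2 / 4 + E ^+ 2.
  by have := sqr_ge0 (beta * V / 2 - E); lra.
have k3 : l * a <= 5 / 4 * beta ^+ 2 * V ^+ 2 + beta * G * V + E ^+ 2.
  have : beta * (l * V ^+ 2) <= beta * (beta * V ^+ 2 + U * V) by rewrite ler_wpM2l.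
  have : beta * V * U <= beta * V * (G + E) by rewrite ler_wpM2l ?mulr_ge0.
  lra.
have k4 : eta * (eta * Lf * (D ^+ 2)) <= eta * (1 / 2 * D ^+ 2).
  by rewrite ler_wpM2l ?(ltW eta0)// ler_wpM2r ?exprn_ge0.
have k5 : eta * (l * a + c) <= eta * (5 / 4 * beta ^+ 2 * V ^+ 2 + beta * G * V
    + E ^+ 2 + D ^+ 2 / 4 + E ^+ 2) by rewrite ler_wpM2l ?(ltW eta0)//; lra.
rewrite exprMn in hsm; lra.
Qed.

(** Young's inequality for the error of [v] is balanced so that its |d|^2 term carries eta^2 like
    the curvature term. Their sum Lg eta^2 |d|^2 is exactly what 2 Lg eta times the decrease in
    [descent_upper] pays for; in return the error of [v] enters without a factor eta. *)
Lemma descent_lower (psi : H -> R) (gradpsi : H -> H) (Lg G eta beta rho r : R)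
    (x u u' v : H) :
  (forall x, is_gradient ip psi x (gradpsi x)) -> Lg.-lipschitz gradpsi ->
  `|u'| <= G -> 0 < eta -> 0 < Lg -> 0 <= beta -> 0 < r -> rho = r ^+ 2 ->
  let d := direction ip beta rho u v in
  psi (x - eta *: d) + eta * beta * `|v| ^+ 2 <=
  psi x + eta * (beta * rho + G * r / 2 + `|u - u'| ^+ 2 / 4 + rho / 4)
        + Lg * eta ^+ 2 * `|d| ^+ 2 + `|v - gradpsi x| ^+ 2 / (2 * Lg).
Proof.
move=> dpsi lip u'G eta0 Lg0 beta0 r0 rhoE; rewrite /=; set d := direction _ _ _ _ _; set e := u - u'.
have rho0 : 0 < rho by rewrite rhoE exprn_gt0.
have := smooth_upper_bound dpsi lip x (x - eta *: d).
have -> : x - eta *: d - x = - (eta *: d) by rewrite addrAC subrr add0r.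
rewrite normrN normrZ (gtr0_norm eta0) ipNr ipZr.
set e' := v - gradpsi x.
have -> : gradpsi x = v - e' by rewrite /e' opprB addrC subrK.
rewrite ipDl ipNl.
have h1 := barrier_ip_direction beta u v rho0.
have h2 := multiplier_rho_le u v beta0 rho0 r0 rhoE.
have h4 := ip_le_norm e' d.
have h5 : `|u| <= G + `|e|.
  by rewrite -(subrK u' u) -/e addrC (le_trans (ler_normD _ _)) ?lerD2r.
move: h1 h2 h4 h5.
rewrite -/d; move: (multiplier ip beta rho u v) (ip v d) (ip e' d) => l a c.
move: (normr_ge0 d) (normr_ge0 e) (normr_ge0 v) (normr_ge0 u).
move: `|d| `|e| `|v| `|u| `|e'| => D E V U E' D0 E0 V0 U0 h1 h2 h4 h5 hsm.
have k1 : eta * (E' * D) <= Lg / 2 * eta ^+ 2 * D ^+ 2 + E' ^+ 2 / (2 * Lg).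
  have : 0 <= (Lg * (eta * D) - E') ^+ 2 / (2 * Lg).
    by rewrite divr_ge0 ?sqr_ge0 ?mulr_ge0 // ltW.
  suff -> : (Lg * (eta * D) - E') ^+ 2 / (2 * Lg) =
    Lg / 2 * eta ^+ 2 * D ^+ 2 + E' ^+ 2 / (2 * Lg) - eta * (E' * D) by lra.
  by field; rewrite gt_eqF.
have k2 : E * r / 2 <= E ^+ 2 / 4 + rho / 4.
  by have := sqr_ge0 (E - r); rewrite rhoE; lra.
have k3 : U * r <= (G + E) * r by rewrite ler_wpM2r // ltW.
have k4 : eta * (beta * V ^+ 2 - a) <=
    eta * (beta * rho + G * r / 2 + E ^+ 2 / 4 + rho / 4).
  by rewrite ler_wpM2l ?(ltW eta0)//; lra.
have k5 : eta * c <= eta * (E' * D) by rewrite ler_wpM2l ?(ltW eta0).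
rewrite exprMn in hsm; lra.
Qed.

(* [psi + 2 Lg eta phi] is the Lyapunov function: the decrease of [phi] absorbs
   the second-order term [Lg eta^2 |d|^2] of [psi]. *)
Lemma lyapunov_step (phi psi : H -> R) (gradphi gradpsi : H -> H)
    (Lf Lg G eta beta rho r : R) (x u v : H) :
  (forall x, is_gradient ip phi x (gradphi x)) -> Lf.-lipschitz gradphi ->
  (forall x, is_gradient ip psi x (gradpsi x)) -> Lg.-lipschitz gradpsi ->
  (forall x, `|gradphi x| <= G) -> 0 < eta -> 0 < Lg ->
  eta * Lf <= 1 / 2 -> 4 * Lg * eta <= 1 ->
  0 <= beta -> beta <= 1 -> 0 < r -> rho = r ^+ 2 ->
  let d := direction ip beta rho u v in
  psi (x - eta *: d) + 2 * Lg * eta * phi (x - eta *: d)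
    + eta * beta * `|v| ^+ 2 / 4 <=
  psi x + 2 * Lg * eta * phi x
    + eta * (beta * rho + G * r / 2 + rho / 4)
    + 8 * Lg ^+ 2 * G ^+ 2 * eta ^+ 3 * beta
    + 2 * eta * `|u - gradphi x| ^+ 2 + `|v - gradpsi x| ^+ 2 / (2 * Lg).
Proof.
move=> dphi lipf dpsi lipg Gb eta0 Lg0 etaL etaLg beta0 beta1 r0 rhoE; rewrite /=; set d := direction _ _ _ _ _.
have rho0 : 0 < rho by rewrite rhoE exprn_gt0.
have hf := descent_upper x u v dphi lipf Gb eta0 etaL beta0 rho0.
have hg := descent_lower x u v dpsi lipg (Gb x) eta0 Lg0 beta0 r0 rhoE.
move: hf hg; rewrite /= -/d.
move: (phi _) (phi _) (psi _) (psi _) => F0 F1 P0 P1.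
have V0 := normr_ge0 v.
move: `|d| `|v| (`|u - gradphi x|) (_ / (2 * Lg)) V0 => D V E Q V0 hf hg.
have etab0 : 0 <= eta * beta by rewrite mulr_ge0 // ltW.
have k0 : 2 * Lg * eta * (F1 + eta * D ^+ 2 / 2) <= 2 * Lg * eta *
    (F0 + eta * (2 * E ^+ 2 + 5 / 4 * beta ^+ 2 * V ^+ 2 + beta * G * V)).
  by rewrite ler_wpM2l // !mulr_ge0 // ltW.
have k4 : 0 <= eta * E ^+ 2 by rewrite mulr_ge0 ?sqr_ge0 // ltW.
have k5 : 0 <= eta * beta * V ^+ 2 by rewrite mulr_ge0 ?sqr_ge0.
have k1 := ler_wpM2r k4 etaLg.
(* Of the decrease eta beta V^2, the quadratic term inherited from [descent_upper] uses 5/8 and its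
   linear term, through [k3], uses 1/8. This leaves the quarter in the statement. *)
have k2 : 4 * Lg * eta * (beta * (eta * beta * V ^+ 2)) <=
    1 * (1 * (eta * beta * V ^+ 2)).
  have Le0 : 0 <= 4 * Lg * eta by rewrite !mulr_ge0 // ltW.
  apply: ler_pM => //; first exact: mulr_ge0.
  by rewrite ler_wpM2r.
have k3 : eta * beta * (2 * Lg * eta * G * V) <=
    eta * beta * (V ^+ 2 / 8 + 8 * Lg ^+ 2 * eta ^+ 2 * G ^+ 2).
  rewrite ler_wpM2l //.
  by have := sqr_ge0 (V / 2 - 4 * Lg * eta * G); lra.
lra.
Qed.

(* The map [v |-> v / (|v|^2 + rho)] is a contraction up to the weights:
   [|v/A - v'/A'|^2 = |v - v'|^2/(A A') - rho (A - A')^2/(A A')^2]. *)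
Lemma regularized_inverse_lipschitz (rho : R) (v w : H) : 0 < rho ->
  let A := `|v| ^+ 2 + rho in let B := `|w| ^+ 2 + rho in
  `|A^-1 *: v - B^-1 *: w| ^+ 2 <= `|v - w| ^+ 2 / (A * B).
Proof.
move=> rho0 /=; set A := _ + rho; set B := _ + rho.
have A0 : 0 < A by rewrite ltr_wpDl ?exprn_ge0.
have B0 : 0 < B by rewrite ltr_wpDl ?exprn_ge0.
have vA : ip v v = A - rho by rewrite -hip /A addrK.
have wB : ip w w = B - rho by rewrite -hip /B addrK.
rewrite !hip !ipE (ipC w v) vA wB -subr_ge0.
rewrite (_ : _ - _ = rho * ((A - B) / (A * B)) ^+ 2); last first.
  by field; rewrite !gt_eqF.
by rewrite mulr_ge0 ?sqr_ge0 // ltW.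
Qed.

(** * Sensitivity of the direction to its two gradient arguments *)

Section DirectionError.
Variables (beta rho r G : R).
Hypotheses (beta_ge0 : 0 <= beta) (r_gt0 : 0 < r) (rhoE : rho = r ^+ 2).

Let rho_gt0 : 0 < rho. Proof. by rewrite rhoE exprn_gt0. Qed.

Let den_gt0 (v : H) : 0 < `|v| ^+ 2 + rho.
Proof. by rewrite ltr_wpDl ?exprn_ge0. Qed.

Let norm_den (v : H) : 2 * r * `|v| <= `|v| ^+ 2 + rho.
Proof. by have := sqr_ge0 (`|v| - r); rewrite rhoE; lra. Qed.

Let num u v : R := Num.max (beta * `|v| ^+ 2 - ip u v) 0.

Let num_ge0 u v : 0 <= num u v. Proof. by rewrite le_max lexx orbT. Qed.

Let num_le u v : num u v <= beta * `|v| ^+ 2 + `|u| * `|v|.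
Proof.
rewrite ge_max addr_ge0 ?mulr_ge0 ?exprn_ge0// andbT lerD2l.
by have := ip_ge_norm u v; lra.
Qed.

Let max0_dist (a b : R) : `|Num.max a 0 - Num.max b 0| <= `|a - b|.
Proof.
rewrite !maxEle; case: (leP a 0); case: (leP b 0) => *; rewrite ler_norml;
  have := ler_norm (a - b); have := lerNnormlW (lexx `|a - b|); lra.
Qed.

(** The positive part is 1-Lipschitz and |v|^2 / (|v|^2 + rho) <= 1, so the constant does not
    deteriorate as rho tends to 0; only the dependence on [v] does. *)
Lemma direction_error_grad (u u' v : H) :
  `|direction ip beta rho u v - direction ip beta rho u' v| <= 2 * `|u - u'|.
Proof.
rewrite /direction opprD addrACA -scalerBl mulr_natl mulr2n.
apply: le_trans (ler_normD _ _) _; rewrite lerD2l normrZ /multiplier -mulrBl.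
rewrite normrM normfV (gtr0_norm (den_gt0 v)) mulrAC ler_pdivrMr //.
apply: (@le_trans _ _ (`|u - u'| * `|v| * `|v|)).
  rewrite ler_wpM2r // (le_trans (max0_dist _ _)) //.
  rewrite (_ : _ - _ = - ip (u - u') v); last by rewrite ipDl ipNl; ring.
  by rewrite normrN normr_ip_le.
by rewrite -mulrA ler_wpM2l // -expr2 lerDl ltW.
Qed.

(** The order of the norms serves twice: it replaces the denominator A B of
    [regularized_inverse_lipschitz] by A^2, which matches the numerator taken at [v], and it gives
    |v| + |w| <= 2 |w| in the variation of the numerator. The general case follows by symmetry. *)
Let direction_error_ordered (u v w : H) : `|u| <= G -> `|v| <= `|w| ->
  `|direction ip beta rho u v - direction ip beta rho u w|
  <= (3 * beta + G / r) * `|v - w|.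
Proof.
move=> uG vw; rewrite /direction opprD addrACA subrr add0r.
rewrite /multiplier -/(num u v) -/(num u w).
set A := `|v| ^+ 2 + rho; set B := `|w| ^+ 2 + rho.
have A0 : 0 < A := den_gt0 v. have B0 : 0 < B := den_gt0 w.
have G0 : 0 <= G := le_trans (normr_ge0 u) uG.
have V0 := normr_ge0 v. have W0 := normr_ge0 w.
have AB : A <= B by rewrite lerD2r ler_pXn2r ?nnegrE.
rewrite (_ : _ - _ = num u v *: (A^-1 *: v - B^-1 *: w)
                     + ((num u v - num u w) / B) *: w); last first.
  by rewrite scalerBr !scalerA mulrBl scalerBl addrA subrK.
have h1 : `|num u v *: (A^-1 *: v - B^-1 *: w)| <= (beta + G / (2 * r)) * `|v - w|.
  have q : `|A^-1 *: v - B^-1 *: w| <= `|v - w| / A.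
    rewrite -(ler_pXn2r (n := 2)) ?nnegrE ?divr_ge0 ?(ltW A0)//.
    apply: le_trans (regularized_inverse_lipschitz v w rho_gt0) _.
    rewrite -/A -/B exprMn ler_wpM2l ?exprn_ge0// exprVn lef_pV2 ?posrE ?mulr_gt0 ?exprn_gt0//.
    by rewrite expr2 ler_pM2l.
  rewrite normrZ (ger0_norm (num_ge0 _ _)).
  apply: (le_trans (ler_wpM2l (num_ge0 _ _) q)).
  rewrite mulrA mulrAC ler_wpM2r // ler_pdivrMr //.
  apply: le_trans (num_le u v) _; rewrite mulrDl lerD //.
    by rewrite ler_wpM2l // /A lerDl ltW.
  rewrite -mulrA; apply: ler_pM => //.
  by rewrite mulrC ler_pdivlMr ?mulr_gt0// mulrC norm_den.
have h2 : `|((num u v - num u w) / B) *: w| <= (2 * beta + G / (2 * r)) * `|v - w|.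
  rewrite normrZ normrM normfV (gtr0_norm B0) mulrAC ler_pdivrMr //.
  have e1 : `|num u v - num u w| <= (2 * beta * `|w| + G) * `|v - w|.
    apply: le_trans (max0_dist _ _) _.
    rewrite (_ : _ - _ = beta * (`|v| ^+ 2 - `|w| ^+ 2) - ip u (v - w)); last first.
      by rewrite ipDr ipNr; ring.
    apply: le_trans (ler_normB _ _) _; rewrite mulrDl lerD //.
      rewrite subr_sqr !normrM (ger0_norm beta_ge0).
      rewrite (ger0_norm (addr_ge0 V0 W0)).
      have := ler_wpM2l beta_ge0 (ler_pM (normr_ge0 _) (addr_ge0 V0 W0)
        (ler_dist_dist v w) (_ : `|v| + `|w| <= 2 * `|w|)).
      by move=> /(_ ltac:(lra)); lra.
    by apply: le_trans (normr_ip_le _ _) _; rewrite ler_wpM2r.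
  apply: (le_trans (ler_wpM2r W0 e1)).
  rewrite mulrAC [leRHS]mulrAC ler_wpM2r //.
  have b1 : 2 * beta * `|w| ^+ 2 <= 2 * beta * B.
    by rewrite ler_wpM2l ?mulr_ge0 // lerDl ltW.
  have b2 : G * `|w| <= G / (2 * r) * B.
    rewrite -mulrA ler_wpM2l // mulrC ler_pdivlMr ?mulr_gt0//.
    by rewrite mulrC norm_den.
  by lra.
apply: le_trans (ler_normD _ _) _; apply: le_trans (lerD h1 h2) _.
rewrite -mulrDl ler_wpM2r // le_eqVlt; apply/orP; left; apply/eqP.
by field; rewrite gt_eqF.
Qed.

Lemma direction_error_norm (u v w : H) : `|u| <= G ->
  `|direction ip beta rho u v - direction ip beta rho u w|
  <= (3 * beta + G / r) * `|v - w|.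
Proof.
move=> uG; case: (leP `|v| `|w|) => [vw|/ltW wv].
  exact: direction_error_ordered.
by rewrite distrC (distrC v); exact: direction_error_ordered.
Qed.

(** The path goes from (u, v) through (u', v) to (u', v'): changing the first argument needs no
    bound on it, while changing the second needs the bound [G], which holds for [u']. *)
Lemma direction_error (u u' v v' : H) : `|u'| <= G ->
  `|direction ip beta rho u' v'| ^+ 2 <=
  2 * `|direction ip beta rho u v| ^+ 2 + 16 * `|u - u'| ^+ 2
  + (72 * beta ^+ 2 + 8 * G ^+ 2 / rho) * `|v - v'| ^+ 2.
Proof.
move=> u'G.
have h1 := direction_error_grad u u' v.
have h2 := direction_error_norm v v' u'G.
have h3 : `|direction ip beta rho u' v'| <= `|direction ip beta rho u v|
    + 2 * `|u - u'| + (3 * beta + G / r) * `|v - v'|.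
  set d := direction _ _ _ u v; pose d1 := direction ip beta rho u' v.
  set d2 := direction _ _ _ u' v'.
  rewrite (_ : d2 = d + (d1 - d) + (d2 - d1)); last first.
    by rewrite [d + _]addrC subrK addrC subrK.
  apply: le_trans (ler_normD _ _) _; apply: lerD; last by rewrite distrC.
  by apply: le_trans (ler_normD _ _) _; rewrite lerD2l distrC; exact: h1.
have h4 := le_trans (normr_ge0 _) h3.
rewrite -(ler_pXn2r (n := 2)) ?nnegrE // in h3.
apply: le_trans h3 _.
have -> : 8 * G ^+ 2 / rho = 8 * (G / r) ^+ 2
  by rewrite rhoE; field; rewrite gt_eqF.
move: `|direction _ _ _ u v| `|u - u'| `|v - v'| (G / r) => D E E' g.
(* Three uses of (s + t)^2 <= 2 s^2 + 2 t^2, whence 16 = 2 * 2 * 2^2, 72 = 2 * 2 * 2 * 3^2 and 8 = 2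
   * 2 * 2. *)
have := sqr_ge0 (D - 2 * E - (3 * beta + g) * E').
have := sqr_ge0 (2 * E - (3 * beta + g) * E').
have := sqr_ge0 ((3 * beta - g) * E').
lra.
Qed.

End DirectionError.

End Hilbert.

(** * Strong measurability *)

Section SimpleMaps.
Context {R : realType} {H : completeNormedModType R}.
Context {d : measure_display} {T : measurableType d}.

Definition simple_map (X : T -> H) :=
  exists2 s : seq (set T * H), measurable_blocks s & X = simple_fct s.

Lemma simple_map_cst (c : H) : simple_map (cst c).
Proof.
exists [:: (setT, c)]; first by move=> p; rewrite inE => /eqP ->; exact: measurableT.
by apply/funext => t; rewrite /simple_fct big_seq1 indicT scale1r.
Qed.

Lemma simple_mapD (X Y : T -> H) :
  simple_map X -> simple_map Y -> simple_map (fun t => X t + Y t).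
Proof.
move=> [s ms ->] [s' ms' ->]; exists (s ++ s').
  by move=> p; rewrite mem_cat => /orP[/ms|/ms'].
by apply/funext => t; rewrite /simple_fct big_cat.
Qed.

Lemma simple_map_indic (A : set T) (X : T -> H) : measurable A ->
  simple_map X -> simple_map (fun t => (\1_A t : R) *: X t).
Proof.
move=> mA [s ms ->]; exists [seq (A `&` p.1, p.2) | p <- s].
  by move=> q /mapP[p /ms mp ->] /=; exact: measurableI.
apply/funext => t; rewrite /simple_fct big_map scaler_sumr.
by apply: eq_bigr => p _; rewrite /= indicI scalerA.
Qed.

Lemma indic_cases (A : set T) (V : lmodType R) (x y : V) t :
  (\1_A t : R) *: x + (\1_(~` A) t : R) *: y = if t \in A then x else y.
Proof.
rewrite !indicE in_setC; case: (t \in A) => /=.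
  by rewrite scale1r scale0r addr0.
by rewrite scale1r scale0r add0r.
Qed.

Lemma simple_fct_cons p (s : seq (set T * H)) (t : T) :
  simple_fct (p :: s) t = if t \in p.1 then p.2 + simple_fct s t else simple_fct s t.
Proof.
rewrite /simple_fct big_cons indicE; case: (t \in p.1) => /=.
  by rewrite scale1r.
by rewrite scale0r add0r.
Qed.

(** Blocks may overlap, so their vectors are not the values of the map. The induction, over all
    [phi], tests membership in the first block and shifts the parameter by its vector there; no
    disjoint refinement is needed. *)
Lemma simple_map_comp (s : seq (set T * H)) (phi : H -> T -> H) :
  measurable_blocks s -> (forall c, simple_map (phi c)) ->
  simple_map (fun t => phi (simple_fct s t) t).
Proof.
elim: s phi => [|p s IH] phi ms mphi.
  by rewrite (_ : (fun _ => _) = phi 0) //; apply/funext => t;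
     rewrite /simple_fct big_nil.
have mp : measurable p.1 by apply: ms; rewrite inE eqxx.
have := IH (fun c t => (\1_(p.1) t : R) *: phi (p.2 + c) t
                       + (\1_(~` p.1) t : R) *: phi c t).
rewrite (_ : (fun t => phi (simple_fct (p :: s) t) t) = (fun t =>
    (\1_(p.1) t : R) *: phi (p.2 + simple_fct s t) t
    + (\1_(~` p.1) t : R) *: phi (simple_fct s t) t)); last first.
  apply/funext => t; rewrite indic_cases simple_fct_cons.
  by case: ifP.
apply=> [q qs|c]; first by apply: ms; rewrite inE qs orbT.
by apply: simple_mapD; apply: simple_map_indic => //; exact: measurableC.
Qed.

Lemma measurable_simple_comp (s : seq (set T * H)) (phi : H -> T -> R) :
  measurable_blocks s -> (forall c, measurable_fun setT (phi c)) ->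
  measurable_fun setT (fun t => phi (simple_fct s t) t).
Proof.
elim: s phi => [|p s IH] phi ms mphi.
  by rewrite (_ : (fun _ => _) = phi 0) //; apply/funext => t;
     rewrite /simple_fct big_nil.
have mp : measurable p.1 by apply: ms; rewrite inE eqxx.
have := IH (fun c t => \1_(p.1) t * phi (p.2 + c) t + \1_(~` p.1) t * phi c t).
rewrite (_ : (fun t => phi (simple_fct (p :: s) t) t) = (fun t =>
    \1_(p.1) t * phi (p.2 + simple_fct s t) t
    + \1_(~` p.1) t * phi (simple_fct s t) t)); last first.
  apply/funext => t.
  by rewrite (indic_cases _ (V := R^o)) simple_fct_cons; case: ifP.
apply=> [q qs|c]; first by apply: ms; rewrite inE qs orbT.
by apply: measurable_funD; apply: measurable_realfun.measurable_funM => //;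
  apply: measurable_indic => //; exact: measurableC.
Qed.

End SimpleMaps.

(* Sequential continuity is the form of continuity that pointwise limits of
   simple maps need. *)
Definition seq_continuous {R : realType} {H V : normedModType R} (phi : H -> V) :=
  forall (u : nat -> H) x, u n @[n --> \oo] --> x ->
  phi (u n) @[n --> \oo] --> phi x.

Definition seq_continuous2 {R : realType} {H V : normedModType R}
    (phi : H -> H -> V) :=
  forall (u v : nat -> H) x y,
  u n @[n --> \oo] --> x -> v n @[n --> \oo] --> y ->
  phi (u n) (v n) @[n --> \oo] --> phi x y.

Section StronglyMeasurable.
Context {R : realType} {H : completeNormedModType R}.
Context {d : measure_display} {T : measurableType d}.

Lemma strongly_measurable_simple (X : nat -> T -> H) (Y : T -> H) :
  (forall n, simple_map (X n)) -> (forall t, X n t @[n --> \oo] --> Y t) ->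
  strongly_measurable Y.
Proof.
move=> sX XY.
have /choice[s sP] : forall n, exists s, measurable_blocks s /\ X n = simple_fct s.
  by move=> n; have [s ms ->] := sX n; exists s.
exists s => [n|t]; first by case: (sP n).
by rewrite (_ : (fun n => _) = X^~ t) //; apply/funext => n; case: (sP n) => _ ->.
Qed.

Lemma strongly_measurable_cst (c : H) : strongly_measurable (fun _ : T => c).
Proof.
by apply: (@strongly_measurable_simple (fun=> cst c)) => [n|t];
  [exact: simple_map_cst|exact: cvg_cst].
Qed.

(** The approximating simple maps are inserted into [phi] directly, and sequential continuity passes
    to the limit. No sigma-algebra on [H] is involved, so [H] may be nonseparable. *)
Lemma strongly_measurable_comp2 (phi : H -> H -> H) (X Y : T -> H) :
  seq_continuous2 phi -> strongly_measurable X -> strongly_measurable Y ->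
  strongly_measurable (fun t => phi (X t) (Y t)).
Proof.
move=> cphi [s ms sX] [s' ms' sY].
apply: (@strongly_measurable_simple
  (fun n t => phi (simple_fct (s n) t) (simple_fct (s' n) t))) => [n|t].
  apply: (@simple_map_comp _ _ _ _ (s n) (fun c t => phi c (simple_fct (s' n) t))) => // c.
  apply: (@simple_map_comp _ _ _ _ (s' n) (fun c' _ => phi c c')) => // c'.
  exact: simple_map_cst.
exact: cphi.
Qed.

Lemma strongly_measurable_comp1 (phi : H -> H) (X : T -> H) :
  seq_continuous phi -> strongly_measurable X ->
  strongly_measurable (fun t => phi (X t)).
Proof.
move=> cphi mX.
by apply: (@strongly_measurable_comp2 (fun x _ => phi x) X X) => // u v x y ux _;
  exact: cphi.
Qed.

Lemma measurable_comp2 (phi : H -> H -> R) (X Y : T -> H) :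
  seq_continuous2 (phi : H -> H -> R^o) ->
  strongly_measurable X -> strongly_measurable Y ->
  measurable_fun setT (fun t => phi (X t) (Y t)).
Proof.
move=> cphi [s ms sX] [s' ms' sY].
apply: (@measurable_fun_cvg _ _ _ _
  (fun n t => phi (simple_fct (s n) t) (simple_fct (s' n) t))) => [n|t _].
  apply: (@measurable_simple_comp _ _ _ _ (s n) (fun c t => phi c (simple_fct (s' n) t))) => // c.
  exact: (@measurable_simple_comp _ _ _ _ (s' n) (fun c' _ => phi c c')).
exact: cphi.
Qed.

Lemma measurable_comp1 (phi : H -> R) (X : T -> H) :
  seq_continuous (phi : H -> R^o) -> strongly_measurable X ->
  measurable_fun setT (fun t => phi (X t)).
Proof.
move=> cphi mX.
by apply: (@measurable_comp2 (fun x _ => phi x) X X) => // u v x y ux _;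
  exact: cphi.
Qed.

Lemma strongly_measurableD (X Y : T -> H) :
  strongly_measurable X -> strongly_measurable Y ->
  strongly_measurable (fun t => X t + Y t).
Proof.
by apply: (strongly_measurable_comp2 (phi := +%R)) => u v x y; exact: cvgD.
Qed.

Lemma strongly_measurableB (X Y : T -> H) :
  strongly_measurable X -> strongly_measurable Y ->
  strongly_measurable (fun t => X t - Y t).
Proof.
by apply: (strongly_measurable_comp2 (phi := fun x y => x - y)) => u v x y;
  exact: cvgB.
Qed.

Lemma strongly_measurableZ (a : R) (X : T -> H) :
  strongly_measurable X -> strongly_measurable (fun t => a *: X t).
Proof.
by apply: (strongly_measurable_comp1 (phi := *:%R a)) => u x ux;
  exact: cvgZl_tmp.
Qed.

Lemma strongly_measurable_sum (n : nat) (X : nat -> T -> H) :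
  (forall i, (i < n)%N -> strongly_measurable (X i)) ->
  strongly_measurable (fun t => \sum_(i < n) X i t).
Proof.
elim: n => [_|n IH mX].
  by under eq_fun do rewrite big_ord0; exact: strongly_measurable_cst.
under eq_fun do rewrite big_ord_recr /=.
apply: strongly_measurableD; last exact: mX.
by apply: IH => i /ltnW; exact: mX.
Qed.

Lemma measurable_normr (X : T -> H) :
  strongly_measurable X -> measurable_fun setT (fun t => `|X t|).
Proof.
by apply: (measurable_comp1 (phi := Num.norm)) => u x; exact: cvg_norm.
Qed.

Lemma measurable_normr2 (X : T -> H) :
  strongly_measurable X -> measurable_fun setT (fun t => `|X t| ^+ 2).
Proof. by move=> /measurable_normr; exact: measurable_funX. Qed.

Lemma strongly_measurable_precomp (d' : measure_display) (T' : measurableType d')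
    (h : T' -> T) (X : T -> H) : measurable_fun setT h ->
  strongly_measurable X -> strongly_measurable (X \o h).
Proof.
move=> mh [s ms sX].
exists (fun n => [seq (h @^-1` p.1, p.2) | p <- s n]) => [n|t].
  move=> q /mapP[p /ms mp ->] /=.
  by rewrite -[_ @^-1` _]setTI; exact: mh.
rewrite (_ : (fun n => _) = fun n => simple_fct (s n) (h t)) //.
by apply/funext => n; rewrite /simple_fct big_map.
Qed.

End StronglyMeasurable.

(** * Sequential continuity of the inner product, the direction and the gradients *)

Section HilbertContinuity.
Variables (R : realType) (H : completeNormedModType R).
Variables (ip : {dot H for idfun}).
Hypothesis hip : hilbert_norm ip.

Lemma seq_continuous2_ip : seq_continuous2 (fun x y => ip x y : R^o).
Proof.
(* Polarization reduces the inner product to norms, whose continuity is available. *)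
have polar x y : ip x y = 2^-1 * (`|x + y| ^+ 2 - `|x| ^+ 2 - `|y| ^+ 2).
  by rewrite !hip !(ipE) (ipC ip y x); field.
move=> u v x y ux vy; rewrite polar; under eq_fun do rewrite polar.
apply: cvgMl_tmp; apply: cvgB; first apply: cvgB.
- by apply: cvgM; apply: cvg_norm; exact: cvgD.
- by apply: cvgM; exact: cvg_norm.
- by apply: cvgM; exact: cvg_norm.
Qed.

Lemma seq_continuous2_direction (beta rho : R) : 0 < rho ->
  seq_continuous2 (fun u v => direction ip beta rho u v).
Proof.
move=> rho0 u v x y ux vy; apply: cvgD => //; apply: cvgZ => //.
have maxE (a : R) : Num.max a 0 = 2^-1 * (a + `|a|).
  rewrite maxEle; case: leP => [/ler0_norm|/gtr0_norm] ->; lra.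
rewrite /multiplier maxE; under eq_fun do rewrite maxE.
have v2 : (`|v n| ^+ 2 : R^o) @[n --> \oo] --> (`|y| ^+ 2 : R^o).
  by apply: cvgM; exact: cvg_norm.
have c : (beta * `|v n| ^+ 2 - ip (u n) (v n) : R^o) @[n --> \oo] -->
   (beta * `|y| ^+ 2 - ip x y : R^o).
  by apply: cvgB; [exact: cvgMl_tmp|exact: seq_continuous2_ip].
apply: cvgM.
  by apply: cvgMl_tmp; apply: cvgD => //; exact: cvg_norm.
apply: cvgV; first by rewrite gt_eqF // ltr_wpDl ?exprn_ge0.
by apply: cvgD => //; exact: cvg_cst.
Qed.

Lemma lipschitz_seq_continuous (h : H -> H) (L : R) :
  L.-lipschitz h -> seq_continuous h.
Proof.
move=> lip u x ux; apply/cvgrPdist_lt => e e0.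
(* [L] may vanish or be negative here; |L| + 1 is a positive Lipschitz constant in every case. *)
have M0 : 0 < e / (`|L| + 1) by rewrite divr_gt0 // ltr_wpDl.
move/cvgrPdist_lt : ux => /(_ _ M0); apply: filterS => n.
rewrite ltr_pdivlMr ?ltr_wpDl// => un.
have := lip (x, u n) (conj I I); rewrite /= => /le_lt_trans; apply.
apply: le_lt_trans un; rewrite mulrC ler_wpM2l //.
by rewrite (le_trans (ler_norm L)) // lerDl.
Qed.

End HilbertContinuity.

(** * Independent samples and minibatches *)

Section IndependentSample.
Context {R : realType} {dO dS dT : measure_display}.
Context {Omega : measurableType dO} {S : measurableType dS} {T : measurableType dT}.
Variables (P : probability Omega R) (PS : probability S R).
Variables (xi : {mfun Omega >-> S}) (q : {mfun Omega >-> T}).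

(** Encodes at once that [xi] has law [PS] (take for [B] the full set) and that it is independent of
    [q]. *)
Definition independent_sample :=
  forall A B, measurable A -> measurable B ->
  P (xi @^-1` A `&` q @^-1` B) = (PS A * P (q @^-1` B))%E.

Hypothesis xi_q : independent_sample.

Let h w := (xi w, q w).

Let mh : measurable_fun setT h.
Proof. exact: measurable_fun_pair. Qed.

Let joint_lawE (X : set (S * T)) : measurable X -> X `<=` setT ->
  pushforward P h X = (PS \x distribution P q)%E X.
Proof.
move=> mX _; apply/esym; move: X mX.
by apply: product_measure_unique => A B mA mB; rewrite -xi_q.
Qed.

(** The joint law is the product of [PS] and the law of [q], so Tonelli integrates over the sample
    first, with the value of [q] frozen. *)
Lemma independent_ge0_integral (phi : S * T -> \bar R) :
  measurable_fun setT phi -> (forall p, 0 <= phi p)%E ->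
  (\int[P]_w phi (xi w, q w) = \int[P]_w \int[PS]_s phi (s, q w))%E.
Proof.
move=> mphi phi0.
have -> : (\int[P]_w phi (xi w, q w) = \int[pushforward P h]_p phi p)%E.
  by rewrite ge0_integral_pushforward.
rewrite (eq_measure_integral _ joint_lawE).
have := @fubini_tonelli2 _ _ _ _ _ PS (distribution P q) phi mphi phi0.
move=> ->; rewrite /fubini_G ge0_integral_distribution //.
  exact: measurable_fun_fubini_tonelli_G.
by move=> t; exact: integral_ge0.
exact: mh.
Qed.

Lemma independent_integral0 (phi : S * T -> R) :
  measurable_fun setT phi -> P.-integrable setT (fun w => (phi (xi w, q w))%:E) ->
  (forall t, \int[PS]_s (phi (s, t))%:E = 0)%E ->
  (\int[P]_w (phi (xi w, q w))%:E = 0)%E.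
Proof.
move=> mphi iphi phi0.
have mE : measurable_fun setT (EFin \o phi) by exact/measurable_EFinP.
have -> : (\int[P]_w (phi (xi w, q w))%:E = \int[pushforward P h]_p (phi p)%:E)%E.
  by rewrite integral_pushforward.
rewrite (eq_measure_integral _ joint_lawE).
have := @integral21_prod_meas1 _ _ _ _ _ PS (distribution P q) (EFin \o phi).
move=> <-; first by rewrite /fubini_G integral0_eq // => t _; exact: phi0.
apply/integrableP; split => //.
rewrite -(eq_measure_integral _ joint_lawE) ge0_integral_pushforward //.
- by case/integrableP : iphi.
- exact: measurableT_comp mE.
- exact: mh.
Qed.

End IndependentSample.

(** * Inner products against a Bochner expectation *)

Section ExpectationInnerProduct.
Variables (R : realType) (H : completeNormedModType R).
Variables (ip : {dot H for idfun}).
Hypothesis hip : hilbert_norm ip.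
Context {d : measure_display} {T : measurableType d} (P : probability T R).

Lemma integral_simple_ip (s : seq (set T * H)) (y : H) : measurable_blocks s ->
  P.-integrable setT (fun t => (ip (simple_fct s t) y)%:E) /\
  (\int[P]_t (ip (simple_fct s t) y)%:E = (ip (simple_expectation P s) y)%:E)%E.
Proof.
elim: s => [|p s IH] ms.
  rewrite /simple_expectation big_nil ip0l.
  rewrite (_ : (fun t => _) = cst 0%E); last first.
    by apply/funext => t; rewrite /simple_fct big_nil ip0l.
  by split; [exact: integrable0|exact: integral0].
have mp : measurable p.1 by apply: ms; rewrite inE eqxx.
have [q qs|is_ Is] := IH; first by apply: ms; rewrite inE qs orbT.
have i1 : P.-integrable setT (fun t => ((ip p.2 y)%:E * (\1_(p.1) t)%:E)%E).
  by apply: integrableZl => //; exact: integrable_indic.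
have E t : (ip (simple_fct (p :: s) t) y)%:E =
    ((ip p.2 y)%:E * (\1_(p.1) t)%:E + (ip (simple_fct s t) y)%:E)%E.
  by rewrite /simple_fct big_cons ipDl ipZl -EFinM -EFinD mulrC.
split; first by under eq_fun do rewrite E; exact: integrableD.
under eq_integral do rewrite E.
rewrite integralD // integralZl//; last exact: integrable_indic.
rewrite integral_indic // setIT Is /simple_expectation big_cons ipDl ipZl mulrC.
by rewrite EFinD EFinM fineK // fin_num_measure.
Qed.

(** The inner product commutes with the expectation of a simple map. Replacing [X] by its n-th
    approximation and [m] by the corresponding simple expectation costs at most [u n], which tends
    to 0, while the integral [I] does not depend on n. *)
Lemma unbiased_ip (X : T -> H) (m y : H) : has_expectation P X m ->
  P.-integrable setT (fun t => (ip (X t - m) y)%:E) ->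
  (\int[P]_t (ip (X t - m) y)%:E = 0)%E.
Proof.
move=> [mX [s [ms s0 sm]]] iZ.
set I := (\int[P]_t _)%E.
pose u n := (`|y|%:E * (\int[P]_t (`|X t - simple_fct (s n) t|)%:E)
  + (`|simple_expectation P (s n) - m| * `|y|)%:E)%E.
have mS n : strongly_measurable (simple_fct (s n)).
  by exists (fun=> s n) => // t; exact: cvg_cst.
have leu n : (`|I| <= u n)%E.
  have [is_ Is] := integral_simple_ip y (ms n).
  pose c := ip m y.
  have ic : P.-integrable setT (EFin \o cst c).
    exact: finite_measure_integrable_cst.
  have iSc : P.-integrable setT (fun t => ((ip (simple_fct (s n) t) y)%:E - c%:E)%E).
    exact: integrableB.
  have E t : (ip (X t - simple_fct (s n) t) y)%:E =
      ((ip (X t - m) y)%:E - ((ip (simple_fct (s n) t) y)%:E - c%:E))%E.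
    by rewrite -!EFinB /c !ipDl !ipNl; congr (_%:E); ring.
  have IE : I = (\int[P]_t (ip (X t - simple_fct (s n) t) y)%:E
      + (ip (simple_expectation P (s n) - m) y)%:E)%E.
    under eq_integral do rewrite E.
    have Ic : (\int[P]_t c%:E = c%:E)%E.
      by rewrite integral_cst // [X in (_ * X)%E](@probability_setT _ _ _ P) mule1.
    rewrite integralB // -/I integralB // Is Ic.
    rewrite ipDl ipNl EFinD EFinN -/c subeK //.
  rewrite IE; apply: le_trans (lee_abs_add _ _) _; apply: leeD; last first.
    by rewrite lee_fin; exact: normr_ip_le.
  have mXS : measurable_fun setT (fun t => `|X t - simple_fct (s n) t|).
    by apply: measurable_normr; exact: strongly_measurableB.
  have mW : measurable_fun setT (fun t => ip (X t - simple_fct (s n) t) y).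
    apply: (measurable_comp2 (phi := fun a b => ip a b)); last first.
    - exact: strongly_measurable_cst.
    - exact: strongly_measurableB.
    - exact: seq_continuous2_ip.
  apply: le_trans (le_abse_integral _ _ _) _ => //; first exact/measurable_EFinP.
  rewrite -ge0_integralZl//; last exact/measurable_EFinP.
  apply: ge0_le_integral => //.
  - by apply: measurableT_comp => //; exact/measurable_EFinP.
  - by apply: measurable_funeM; exact/measurable_EFinP.
  - by move=> t _; rewrite /= lee_fin mulrC; exact: normr_ip_le.
have u0 : u n @[n --> \oo] --> 0%E.
  rewrite -[0%E]adde0 -[X in (X + _)%E](mule0 `|y|%:E); apply: cvgeD => //.
    exact: cvgeZl.
  apply: cvg_EFin; first by near=> n.
  have : `|simple_expectation P (s n) - m| * `|y| @[n --> \oo] --> `|m - m| * `|y|.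
    have cm : simple_expectation P (s n) - m @[n --> \oo] --> m - m.
      by apply: cvgB => //; exact: cvg_cst.
    by apply: cvgMr_tmp; apply: cvg_norm.
  by rewrite subrr normr0 mul0r.
have : (`|I| <= 0)%E by apply: (cvge_to_ge u0); near=> n; exact: leu.
move=> I0; apply/eqP; rewrite -abse_eq0 eq_le I0; exact: abse_ge0.
Unshelve. all: by end_near. Qed.

End ExpectationInnerProduct.

Section SecondMoments.
Variables (R : realType) (H : completeNormedModType R).
Variables (ip : {dot H for idfun}).
Hypothesis hip : hilbert_norm ip.
Context {d : measure_display} {T : measurableType d} (P : probability T R).

Lemma integrable_normr2 (X : T -> H) (A : R) : strongly_measurable X ->
  (\int[P]_t (`|X t| ^+ 2)%:E <= A%:E)%E ->
  P.-integrable setT (fun t => (`|X t| ^+ 2)%:E).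
Proof.
move=> mX XA; apply/integrableP; split.
  by apply/measurable_EFinP; exact: measurable_normr2.
apply: le_lt_trans (ltry A); apply: le_trans XA.
by under eq_integral do rewrite gee0_abs ?lee_fin ?exprn_ge0//.
Qed.

Lemma integrable_ip (X Y : T -> H) (A B : R) :
  strongly_measurable X -> strongly_measurable Y ->
  (\int[P]_t (`|X t| ^+ 2)%:E <= A%:E)%E ->
  (\int[P]_t (`|Y t| ^+ 2)%:E <= B%:E)%E ->
  P.-integrable setT (fun t => (ip (X t) (Y t))%:E).
Proof.
move=> mX mY XA YB.
have iXY := integrableD measurableT (integrable_normr2 mX XA) (integrable_normr2 mY YB).
apply: le_integrable iXY => //.
  apply/measurable_EFinP; apply: (measurable_comp2 (phi := fun a b => ip a b)) => //.
  exact: seq_continuous2_ip.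
move=> t _; rewrite -EFinD !abse_EFin lee_fin.
rewrite (ger0_norm (addr_ge0 _ _)) ?exprn_ge0//.
apply: le_trans (normr_ip_le hip _ _) _.
have := sqr_ge0 (`|X t| - `|Y t|); have := sqr_ge0 (`|X t| + `|Y t|); lra.
Qed.

End SecondMoments.

(** * Second moments of the error of a single sample *)

Section SampleError.
Variables (R : realType) (H : completeNormedModType R).
Variables (ip : {dot H for idfun}).
Hypothesis hip : hilbert_norm ip.
Context {dO dS dT : measure_display}.
Context {Omega : measurableType dO} {S : measurableType dS} {T : measurableType dT}.
Variables (P : probability Omega R) (PS : probability S R).
Variables (G : S -> H -> H) (gr : H -> H) (sigma2 : R).
Hypotheses (G_meas : jointly_measurable G)
  (G_unbiased : forall x, has_expectation PS (fun s => G s x) (gr x))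
  (G_variance : forall x,
     ('E_PS[fun s => (`|G s x - gr x| ^+ 2)%R] <= sigma2%:E)%E)
  (gr_cont : seq_continuous gr).
Variables (xi : {mfun Omega >-> S}) (q : {mfun Omega >-> T}).
Hypothesis xi_q : independent_sample P PS xi q.
Variable (X : T -> H).
Hypothesis mX : strongly_measurable X.

Let errT (p : S * T) := G p.1 (X p.2) - gr (X p.2).
Let err w := G (xi w) (X (q w)) - gr (X (q w)).

Let msnd (Y : T -> H) : strongly_measurable Y ->
  strongly_measurable (fun p : S * T => Y p.2).
Proof. by move=> mY; exact: (strongly_measurable_precomp measurable_snd mY). Qed.

Let merrT : strongly_measurable errT.
Proof.
apply: strongly_measurableB; first exact: G_meas.
exact: (msnd (strongly_measurable_comp1 gr_cont mX)).
Qed.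

Let mh : measurable_fun setT (fun w => (xi w, q w)).
Proof. exact: measurable_fun_pair. Qed.

Let merr : strongly_measurable err.
Proof. exact: (strongly_measurable_precomp mh merrT). Qed.

Let variance x : (\int[PS]_s (`|G s x - gr x| ^+ 2)%:E <= sigma2%:E)%E.
Proof. by have := G_variance x; rewrite unlock. Qed.

Lemma sample_error_second_moment :
  (\int[P]_w (`|err w| ^+ 2)%:E <= sigma2%:E)%E.
Proof.
have mphi : measurable_fun setT (fun p => (`|errT p| ^+ 2)%:E).
  by apply/measurable_EFinP; exact: measurable_normr2.
rewrite (independent_ge0_integral xi_q mphi); last first.
  by move=> p; rewrite lee_fin exprn_ge0.
apply: (@le_trans _ _ (\int[P]_w (cst sigma2%:E w))%E); last first.
  by rewrite integral_cst // [X in (_ * X)%E](@probability_setT _ _ _ P) mule1.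
apply: ge0_le_integral => //.
- by move=> w _; apply: integral_ge0 => s _; rewrite lee_fin sqr_ge0.
- have phi0 (p : S * T) : (0 <= (`|errT p| ^+ 2)%:E)%E by rewrite lee_fin exprn_ge0.
  have mG := @measurable_fun_fubini_tonelli_G _ _ _ _ _ PS _ mphi phi0.
  exact: (measurableT_comp mG).
- by move=> w _; exact: (variance (X (q w))).
Qed.

(** With [q] frozen, [Y] is a constant vector and the error has mean zero by unbiasedness. The
    second moments provide the integrability that Fubini needs. *)
Lemma sample_error_orthogonal (Y : T -> H) (A : R) : strongly_measurable Y ->
  (\int[P]_w (`|Y (q w)| ^+ 2)%:E <= A%:E)%E ->
  (\int[P]_w (ip (err w) (Y (q w)))%:E = 0)%E.
Proof.
move=> mY YA.
have mYq : strongly_measurable (fun w => Y (q w)).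
  exact: (strongly_measurable_precomp _ mY).
apply: (@independent_integral0 _ _ _ _ _ _ _ _ _ _ _ xi_q
  (fun p => ip (errT p) (Y p.2))).
- apply: (measurable_comp2 (phi := fun a b => ip a b)) => //; last exact: msnd.
  exact: seq_continuous2_ip.
- exact: (integrable_ip hip merr mYq sample_error_second_moment YA).
- move=> t; apply: (@unbiased_ip _ _ _ hip _ _ PS (fun s => G s (X t)) (gr (X t)) (Y t)) => //=.
  have mG : strongly_measurable (fun s => G s (X t) - gr (X t)).
    apply: strongly_measurableB; last exact: strongly_measurable_cst.
    by have [] := G_unbiased (X t).
  apply: (integrable_ip hip mG (strongly_measurable_cst (Y t)) (variance _)
    (B := `|Y t| ^+ 2)).
  by rewrite integral_cst // [X in (_ * X)%E](@probability_setT _ _ _ PS) mule1.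
Qed.

(** Pythagoras: the cross term has integral zero, so a fresh sample adds at most [sigma2] to the
    second moment of whatever is determined by [q]. *)
Lemma sample_error_add (Y : T -> H) (A : R) : strongly_measurable Y ->
  (\int[P]_w (`|Y (q w)| ^+ 2)%:E <= A%:E)%E ->
  (\int[P]_w (`|Y (q w) + err w| ^+ 2)%:E <= (A + sigma2)%:E)%E.
Proof.
move=> mY YA.
have mYq : strongly_measurable (fun w => Y (q w)).
  exact: (strongly_measurable_precomp _ mY).
have E w : ((`|Y (q w) + err w| ^+ 2)%:E = (`|Y (q w)| ^+ 2)%:E
    + (`|err w| ^+ 2)%:E + 2%:E * (ip (err w) (Y (q w)))%:E)%E.
  move: (err w) (Y (q w)) => e y.
  rewrite -EFinM -!EFinD !hip !ipE (ipC ip y e); congr (_%:E); ring.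
under eq_integral do rewrite E.
have i1 := integrable_normr2 mYq YA.
have i2 := integrable_normr2 merr sample_error_second_moment.
have i3 := integrable_ip hip merr mYq sample_error_second_moment YA.
rewrite integralD //; [|exact: integrableD|exact: integrableZl].
rewrite integralD // integralZl // (sample_error_orthogonal mY YA) mule0 adde0.
by rewrite EFinD; apply: leeD => //; exact: sample_error_second_moment.
Qed.

End SampleError.

(** * Sigma-algebras generated by groups of draws, and their independence *)

Section Cylinders.
Context {d : measure_display} {Omega : measurableType d} {I : choiceType}.
Variable F : I -> set (set Omega).

(* Unlike the union of the [F i], this generator of the same sigma-algebra is
   closed under intersection. *)
Definition cylinder (J : set I) : set (set Omega) :=
  [set A | exists (s : seq I) (E : I -> set Omega),
     [/\ uniq s, forall i, i \in s -> J i /\ F i (E i) &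
         A = \bigcap_(i in [set i | i \in s]) E i]].

Lemma cylinder_subset (J J' : set I) : J `<=` J' -> cylinder J `<=` cylinder J'.
Proof.
move=> JJ' A [s [E [us sE AE]]]; exists s, E; split => // i /sE[/JJ' ? ?].
by split.
Qed.

Lemma cylinder1 (J : set I) i A : J i -> F i A -> cylinder J A.
Proof.
move=> Ji FA; exists [:: i], (fun=> A); split => // [k|].
  by rewrite inE => /eqP ->.
apply/seteqP; split => w; last by move=> /(_ i); apply; rewrite /= inE.
by move=> Aw k /=.
Qed.

Lemma cylinderT (J : set I) : cylinder J setT.
Proof.
exists [::], (fun=> setT); split => //.
by apply/seteqP; split => w.
Qed.

Hypotheses (FT : forall i, F i setT) (FI : forall i, setI_closed (F i)).

(** Both families are padded with the full set to the union of the two index lists and then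
    intersected index by index. *)
Lemma cylinder_setI_closed (J : set I) : setI_closed (cylinder J).
Proof.
move=> A B [s [E [us sE ->]]] [s' [E' [us' sE' ->]]].
pose E1 i := if i \in s then E i else setT.
pose E2 i := if i \in s' then E' i else setT.
exists (undup (s ++ s')), (fun i => E1 i `&` E2 i); split.
- exact: undup_uniq.
- move=> i; rewrite mem_undup mem_cat => iss.
  have F1 : F i (E1 i) by rewrite /E1; case: ifP => // /sE[].
  have F2 : F i (E2 i) by rewrite /E2; case: ifP => // /sE'[].
  by split; [case/orP: iss => [/sE[]|/sE'[]]|exact: FI].
- apply/seteqP; split => w.
    move=> [Ew E'w] i /= _; rewrite /E1 /E2.
    by split; case: ifPn => // is_; [exact: Ew|exact: E'w].
  move=> EE; split => i /= is_.
    have /= := EE i; rewrite mem_undup mem_cat is_ /E1 is_ => /(_ isT)[]; by [].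
  have /= := EE i; rewrite mem_undup mem_cat is_ orbT /E2 is_ => /(_ isT)[]; by [].
Qed.

Hypothesis Fm : forall i, F i `<=` measurable.

(** A cylinder is a finite intersection of events, by induction on its list of indices. *)
Lemma cylinder_measurable (J : set I) : cylinder J `<=` measurable.
Proof.
move=> A [s [E [us sE ->]]].
rewrite bigcap_seq.
elim: s us sE => [|i s IH] us sE; first by rewrite big_nil; exact: measurableT.
rewrite big_cons; apply: measurableI.
  by have [|_ /Fm] := sE i; first by rewrite inE eqxx.
apply: IH => [|k ks]; first by case/andP: us.
by apply: sE; rewrite inE ks orbT.
Qed.

Variables (R : realType) (P : probability Omega R) (D : set I).
Hypothesis indep : mutually_independent P D F.

(** A uniqueness argument on an intersection-stable generator: the finite measures C |-> P (C [&] B)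
    and C |-> P C * P B agree on cylinders by mutual independence, hence on the sigma-algebra they
    generate. *)
Lemma cylinder_independent (J : set I) (j : I) (A B : set Omega) :
  J `<=` D -> D j -> ~ J j -> <<s cylinder J >> A -> F j B ->
  P (A `&` B) = (P A * P B)%E.
Proof.
move=> JD Dj Jj sA FB.
have mB : measurable B := Fm FB.
have PB0 : 0 <= fine (P B) by rewrite fine_ge0.
pose m1 := mrestr P mB.
pose m2 := mscale (NngNum PB0) P.
have m2E C : m2 C = (P C * P B)%E.
  by rewrite /m2 /mscale /= fineK ?fin_num_measure// muleC.
rewrite -m2E.
apply: (@g_sigma_algebra_measure_unique _ _ _ (cylinder J) _ (fun=> setT) _ _ m1 m2).
- exact: cylinder_measurable.
- by move=> _; exact: cylinderT.
- by apply/seteqP; split => w // _; exists 0%N.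
- exact: cylinder_setI_closed.
- move=> C [s [E [us sE ->]]]; rewrite -[RHS]/(m2 _) m2E -[LHS]/(P (_ `&` B)).
  have js : j \notin s by apply/negP => /sE[].
  (* The event [B] is attached to the new index [j]. Mutual independence is then applied to both [s]
     and [j :: s], and the common product over [s] is eliminated. *)
  pose E' i := if i == j then B else E i.
  have E'j : E' j = B by rewrite /E' eqxx.
  have E's i : i \in s -> E' i = E i.
    by rewrite /E'; case: eqP => // -> ; rewrite (negbTE js).
  have := indep (J := j :: s) (E := E'); rewrite /= js us big_cons.
  have -> : (\prod_(i <- s) P (E' i) = \prod_(i <- s) P (E i))%E.
    by apply: eq_big_seq => i /E's ->.
  rewrite (indep (J := s) (E := E)) //; last by move=> i /sE[/JD].
  rewrite E'j muleC => <- //; last first.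
    move=> i; rewrite inE => /orP[/eqP ->|is_]; first by rewrite E'j.
    by rewrite E's //; have [/JD] := sE _ is_.
  congr (P _); apply/seteqP; split => w /=.
    move=> [Ew Bw] i /=; rewrite inE => /orP[/eqP ->|is_]; first by rewrite E'j.
    by rewrite E's //; exact: Ew.
  move=> EE; split; last by have := EE j; rewrite /= E'j inE eqxx; exact.
  by move=> i /= is_; have := EE i; rewrite /= E's // inE is_ orbT; exact.
- move=> k; apply: (@le_lt_trans _ _ 1%E); last exact: ltry.
  by apply: probability_le1; exact: measurableI.
- exact: sA.
Qed.

End Cylinders.

(** * Random vectors determined by a set of draws *)

Section Past.
Context {R : realType} {dO df dg : measure_display}.
Context {Omega : measurableType dO} {Sf : measurableType df}
  {Sg : measurableType dg}.
Variables (xi : nat -> nat -> {mfun Omega >-> Sf})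
  (zeta : nat -> nat -> {mfun Omega >-> Sg}) (N : {mfun Omega >-> nat}).

Let F := draw_events xi zeta N.

Lemma preimage_eventsT (d' : measure_display) (S : measurableType d')
  (X : Omega -> S) : g_sigma_algebra_preimage X setT.
Proof. by exists setT => //; rewrite preimage_setT setTI. Qed.

Lemma preimage_eventsI (d' : measure_display) (S : measurableType d')
  (X : Omega -> S) : setI_closed (g_sigma_algebra_preimage X).
Proof.
move=> _ _ [A mA <-] [B mB <-]; exists (A `&` B); first exact: measurableI.
by rewrite !setTI.
Qed.

Lemma preimage_events_measurable (d' : measure_display) (S : measurableType d')
  (X : {mfun Omega >-> S}) : g_sigma_algebra_preimage X `<=` measurable.
Proof. by move=> _ [A mA <-]; exact: measurable_funP. Qed.

Lemma draw_eventsT i : F i setT.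
Proof. by case: i => [[[k i]|[k i]]|u]; exact: preimage_eventsT. Qed.

Lemma draw_eventsI i : setI_closed (F i).
Proof. by case: i => [[[k i]|[k i]]|u]; exact: preimage_eventsI. Qed.

Lemma draw_events_measurable i : F i `<=` measurable.
Proof. by case: i => [[[k i]|[k i]]|u]; exact: preimage_events_measurable. Qed.

Notation past J := (g_sigma_algebraType (cylinder F J)).

(** The identity of [Omega], seen as a random element of the space whose events are generated by the
    draws in [J]. Adaptedness becomes strong measurability on that space, and the results on
    independent pairs apply with this map as [q]. *)
Definition to_past (J : set draw) (w : Omega) : past J := w.

Lemma measurable_to_past J : measurable_fun setT (to_past J).
Proof.
apply: measurability; first by [].
move=> _ [A cA <-]; rewrite setTI.
exact: (cylinder_measurable draw_events_measurable cA).
Qed.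

HB.instance Definition _ J :=
  isMeasurableFun.Build _ _ Omega (past J) (to_past J) (@measurable_to_past J).

Definition adapted {H : completeNormedModType R} (J : set draw) (X : Omega -> H) :=
  strongly_measurable (X : past J -> H).

Lemma measurable_past_subset (J J' : set draw) : J `<=` J' ->
  measurable_fun setT (id : past J' -> past J).
Proof.
move=> JJ'; apply: measurability; first by [].
move=> _ [A cA <-]; rewrite setTI.
by apply: sub_sigma_algebra; exact: (cylinder_subset JJ').
Qed.

Lemma adapted_subset (H : completeNormedModType R) (J J' : set draw) (X : Omega -> H) :
  J `<=` J' -> adapted J X -> adapted J' X.
Proof.
by move=> JJ' aX; exact: (strongly_measurable_precomp (measurable_past_subset JJ') aX).
Qed.

Lemma adapted_measurable (H : completeNormedModType R) (J : set draw) (X : Omega -> H) :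
  adapted J X -> strongly_measurable X.
Proof.
by move=> aX; exact: (strongly_measurable_precomp (@measurable_to_past J) aX).
Qed.

(** * Minibatches drawn from one family of samples, labelled by [c] *)

Section Batch.
Context {dS : measure_display} {S : measurableType dS}.
Variables (P : probability Omega R) (PS : probability S R).
Variables (D : set draw) (c : nat -> draw) (X_ : nat -> {mfun Omega >-> S}) (B : nat).
Hypothesis indep : mutually_independent P D F.
Hypothesis cE : forall i, F (c i) = g_sigma_algebra_preimage (X_ i).
Hypothesis c_inj : injective c.
Hypothesis cD : forall i, (i < B)%N -> D (c i).
Hypothesis law : forall i A, (i < B)%N -> measurable A -> P (X_ i @^-1` A) = PS A.

Lemma independent_draw (J : set draw) i : (i < B)%N -> J `<=` D -> ~ J (c i) ->
  independent_sample P PS (X_ i) (to_past J).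
Proof.
move=> iB JD nJ A C mA mC; rewrite setIC /=.
rewrite (@cylinder_independent _ _ _ F draw_eventsT draw_eventsI
  draw_events_measurable _ P D indep J (c i)) //.
- by rewrite law // muleC.
- exact: cD.
- by rewrite cE; exists A => //; rewrite setTI.
Qed.

Lemma measurable_draw (J : set draw) i : J (c i) ->
  measurable_fun setT (X_ i : past J -> S).
Proof.
move=> Ji _ A mA; rewrite setTI.
apply: sub_sigma_algebra; apply: (cylinder1 Ji).
by rewrite cE; exists A => //; rewrite setTI.
Qed.

Variables (H : completeNormedModType R) (G : S -> H -> H).
Hypothesis G_meas : jointly_measurable G.

Lemma adapted_draw (J : set draw) i (X : Omega -> H) :
  J (c i) -> adapted J X -> adapted J (fun w => G (X_ i w) (X w)).
Proof.
move=> Ji aX; have := G_meas aX => mG.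
have mh : measurable_fun setT ((fun w => (X_ i w, w)) : past J -> S * past J).
  by apply: measurable_fun_pair; [exact: measurable_draw|exact: measurable_id].
exact: (strongly_measurable_precomp mh mG).
Qed.

Lemma adapted_minibatch (J : set draw) (X : Omega -> H) :
  (forall i, (i < B)%N -> J (c i)) -> adapted J X ->
  adapted J (fun w => minibatch G B (fun i => X_ i w) (X w)).
Proof.
move=> Jc aX; apply: strongly_measurableZ.
apply: (@strongly_measurable_sum _ _ _ (past J) B (fun i w => G (X_ i w) (X w))).
by move=> i /Jc Ji; exact: adapted_draw.
Qed.

Variables (ip : {dot H for idfun}) (gr : H -> H) (sigma2 : R).
Hypothesis hip : hilbert_norm ip.
Hypotheses
  (G_unbiased : forall x, has_expectation PS (fun s => G s x) (gr x))
  (G_variance : forall x,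
     ('E_PS[fun s => (`|G s x - gr x| ^+ 2)%R] <= sigma2%:E)%E)
  (gr_cont : seq_continuous gr).

(** The first n errors are determined by [J] and the first n draws of the batch, of which the next
    draw is independent. Each draw thus adds at most [sigma2], and the bound grows like n instead of
    n^2. *)
Lemma batch_error_second_moment (J : set draw) (X : Omega -> H) n :
  J `<=` D -> (forall i, ~ J (c i)) -> adapted J X -> (n <= B)%N ->
  (\int[P]_w (`|\sum_(i < n) (G (X_ i w) (X w) - gr (X w))| ^+ 2)%:E
     <= (n%:R * sigma2)%:E)%E.
Proof.
move=> JD nJ aX; elim: n => [_|n IH nB].
  under eq_integral do rewrite big_ord0 normr0 expr0n /=.
  by rewrite integral0 mul0r.
pose J' := J `|` [set c i | i in [set i | (i < n)%N]].
have JJ' : J `<=` J' by move=> j Jj; left.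
have J'D : J' `<=` D.
  by move=> j [/JD //|[i /= in_ <-]]; apply: cD; exact: ltn_trans nB.
have nJ' : ~ J' (c n).
  by move=> [/nJ //|[i /= in_ /c_inj ni]]; rewrite ni ltnn in in_.
have aX' := adapted_subset JJ' aX.
under eq_integral do rewrite big_ord_recr /=.
have := @sample_error_add R H ip hip _ _ _ Omega S (past J') P PS G gr sigma2
  G_meas G_unbiased G_variance gr_cont (X_ n) (to_past J')
  (independent_draw nB J'D nJ') X aX'
  (fun w => \sum_(i < n) (G (X_ i w) (X w) - gr (X w))) (n%:R * sigma2).
rewrite -natr1 mulrDl mul1r; apply; last exact: (IH (ltnW nB)).
apply: (@strongly_measurable_sum _ _ _ (past J') n (fun i w => G (X_ i w) (X w) - gr (X w))).
move=> i in_; apply: strongly_measurableB; last exact: strongly_measurable_comp1.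
by apply: adapted_draw => //; right; exists i.
Qed.

Lemma minibatch_variance (J : set draw) (X : Omega -> H) :
  J `<=` D -> (forall i, ~ J (c i)) -> adapted J X -> (0 < B)%N ->
  (\int[P]_w (`|minibatch G B (fun i => X_ i w) (X w) - gr (X w)| ^+ 2)%:E
     <= (sigma2 / B%:R)%:E)%E.
Proof.
move=> JD nJ aX B0.
have B0' : B%:R != 0 :> R by rewrite pnatr_eq0 -lt0n.
have E w : ((`|minibatch G B (fun i => X_ i w) (X w) - gr (X w)| ^+ 2)%:E =
   (B%:R ^- 2)%:E * (`|\sum_(i < B) (G (X_ i w) (X w) - gr (X w))| ^+ 2)%:E)%E.
  rewrite -EFinM /minibatch sumrB sumr_const card_ord.
  rewrite -[gr (X w) *+ B]scaler_nat.
  rewrite -{1}[gr (X w)](scalerK B0') -scalerBr normrZ exprMn normfV exprVn.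
  by rewrite normr_nat.
under eq_integral do rewrite E.
have mS : strongly_measurable (fun w => \sum_(i < B) (G (X_ i w) (X w) - gr (X w))).
  apply: (@strongly_measurable_sum _ _ _ _ B (fun i w => G (X_ i w) (X w) - gr (X w))).
  move=> i iB; have aX' : adapted (J `|` [set c i]) X.
    by apply: adapted_subset aX => j; left.
  apply: strongly_measurableB; last first.
    exact: (strongly_measurable_comp1 gr_cont (adapted_measurable aX)).
  by apply: (adapted_measurable (J := J `|` [set c i])); apply: adapted_draw => //; right.
rewrite ge0_integralZl //; last first.
  by apply/measurable_EFinP; exact: measurable_normr2.
apply: le_trans (lee_wpmul2l _ (batch_error_second_moment JD nJ aX (leqnn B))) _.
  by rewrite lee_fin invr_ge0 exprn_ge0.
by rewrite -EFinM lee_fin le_eqVlt; apply/orP; left; apply/eqP; field.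
Qed.

End Batch.

End Past.

(** * The iterates, their minibatch variances and the random output index *)

Section Iterates.
Variables (R : realType) (H : completeNormedModType R).
Variables (ip : {dot H for idfun}).
Hypothesis hip : hilbert_norm ip.
Context {dO df dg : measure_display}.
Context {Omega : measurableType dO} {Sf : measurableType df}
  {Sg : measurableType dg}.
Variables (P : probability Omega R) (Pf : probability Sf R) (Pg : probability Sg R).
Variables (Phi : Sf -> H -> R) (gradF : Sf -> H -> H) (phi : H -> R) (gradf : H -> H).
Variables (Psi : Sg -> H -> R) (gradG : Sg -> H -> H) (psi : H -> R) (gradg : H -> H).
Variables (Lf Lg sigmaf2 sigmag2 : R).
Hypotheses (hf : stochastic_objective ip Pf Phi gradF phi gradf Lf sigmaf2)
  (hg : stochastic_objective ip Pg Psi gradG psi gradg Lg sigmag2).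
Variables (eta beta rho : nat -> R) (Bf Bg : nat -> nat) (x0 : H).
Hypothesis rho_gt0 : forall k, 0 < rho k.
Variables (wt : nat -> R) (K : nat).
Variables (xi : nat -> nat -> {mfun Omega >-> Sf})
  (zeta : nat -> nat -> {mfun Omega >-> Sg}) (N : {mfun Omega >-> nat}).
Hypothesis samp : sampling P Pf Pg Bf Bg wt K xi zeta N.

Definition iterate k w := sdbgd ip gradF gradG eta beta rho Bf Bg x0
  (fun l i => xi l i w) (fun l j => zeta l j w) k.

Definition batchf k w := minibatch gradF (Bf k) (fun i => xi k i w) (iterate k w).
Definition batchg k w := minibatch gradG (Bg k) (fun j => zeta k j w) (iterate k w).

Lemma iterateS k w : iterate k.+1 w = iterate k w
  - eta k *: direction ip (beta k) (rho k) (batchf k w) (batchg k w).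
Proof. by []. Qed.

(** Draws beyond the batch sizes are left out because independence is assumed on [drawn] only. *)
Let before (k : nat) : set draw :=
  [set i | drawn Bf Bg i /\ match i with
   | inl (inl (l, _)) => (l < k)%N
   | inl (inr (l, _)) => (l < k)%N
   | inr _ => False
   end].

Let before_subset k l : (k <= l)%N -> before k `<=` before l.
Proof.
move=> kl [[[m i]|[m i]]|u] [Di mk]; split => //; exact: leq_trans mk kl.
Qed.

Let indep : mutually_independent P (drawn Bf Bg) (draw_events xi zeta N).
Proof. by case: samp. Qed.

Notation adapted := (adapted xi zeta N).
Notation past J := (g_sigma_algebraType (cylinder (draw_events xi zeta N) J)).

Let contf : seq_continuous gradf.
Proof. exact: lipschitz_seq_continuous (gradient_lipschitz hf). Qed.

Let contg : seq_continuous gradg.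
Proof. exact: lipschitz_seq_continuous (gradient_lipschitz hg). Qed.

(** The adaptedness of the iterate is a premise because the result serves inside the induction that
    proves it. *)
Let adapted_batchf_of k : adapted (before k) (iterate k) ->
  adapted (before k.+1) (batchf k).
Proof.
move=> aX; apply: (adapted_minibatch (c := fun i => inl (inl (k, i)))) => //.
- exact: sample_gradient_measurable hf.
- exact: (adapted_subset (before_subset (leqnSn k)) aX).
Qed.

Let adapted_batchg_of k : adapted (before k) (iterate k) ->
  adapted (before k.+1) (batchg k).
Proof.
move=> aX; apply: (adapted_minibatch (c := fun i => inl (inr (k, i)))) => //.
- exact: sample_gradient_measurable hg.
- exact: (adapted_subset (before_subset (leqnSn k)) aX).
Qed.

Lemma adapted_iterate k : adapted (before k) (iterate k).
Proof.
elim: k => [|k aX]; first exact: strongly_measurable_cst.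
apply: strongly_measurableB.
  exact: (adapted_subset (before_subset (leqnSn k)) aX).
apply: strongly_measurableZ.
apply: (strongly_measurable_comp2 (phi := direction ip (beta k) (rho k))).
- exact: seq_continuous2_direction.
- exact: adapted_batchf_of.
- exact: adapted_batchg_of.
Qed.

Lemma batchf_variance k : (0 < Bf k)%N ->
  (\int[P]_w (`|batchf k w - gradf (iterate k w)| ^+ 2)%:E
     <= (sigmaf2 / (Bf k)%:R)%:E)%E.
Proof.
move=> B0; case: (samp) => lawf _ _ _.
apply: (@minibatch_variance _ _ _ _ _ _ _ xi zeta N _ _ P Pf (drawn Bf Bg)
  (fun i => inl (inl (k, i))) (xi k) (Bf k) _ _ _ _ _ H gradF _ ip gradf
  sigmaf2 hip _ _ _ (before k)) => //.
- by move=> i j [].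
- by move=> i A iB mA; exact: lawf.
- exact: sample_gradient_measurable hf.
- exact: gradient_unbiased hf.
- exact: gradient_variance hf.
- by move=> j [].
- by move=> i [_]; rewrite /= ltnn.
- exact: adapted_iterate.
Qed.

Lemma batchg_variance k : (0 < Bg k)%N ->
  (\int[P]_w (`|batchg k w - gradg (iterate k w)| ^+ 2)%:E
     <= (sigmag2 / (Bg k)%:R)%:E)%E.
Proof.
move=> B0; case: (samp) => _ lawg _ _.
apply: (@minibatch_variance _ _ _ _ _ _ _ xi zeta N _ _ P Pg (drawn Bf Bg)
  (fun i => inl (inr (k, i))) (zeta k) (Bg k) _ _ _ _ _ H gradG _ ip gradg
  sigmag2 hip _ _ _ (before k)) => //.
- by move=> i j [].
- by move=> i A iB mA; exact: lawg.
- exact: sample_gradient_measurable hg.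
- exact: gradient_unbiased hg.
- exact: gradient_variance hg.
- by move=> j [].
- by move=> i [_]; rewrite /= ltnn.
- exact: adapted_iterate.
Qed.

Let samples : set draw :=
  [set i | drawn Bf Bg i /\ match i with inr _ => False | _ => True end].

Let before_samples k : before k `<=` samples.
Proof. by move=> [[[m i]|[m i]]|u] []. Qed.

Section RandomIndex.
Variable h : nat -> H -> R.
Hypotheses (h_cont : forall k, seq_continuous (h k : H -> R^o))
  (h_ge0 : forall k x, 0 <= h k x).

Let mh k : measurable_fun setT (fun w => h k (iterate k w)).
Proof.
apply: measurable_comp1 => //.
exact: (adapted_measurable (adapted_iterate k)).
Qed.

Let mhN : measurable_fun setT (fun w => h (N w) (iterate (N w) w)).
Proof.
move=> _ A mA; rewrite setTI.
have -> : (fun w => h (N w) (iterate (N w) w)) @^-1` A = \bigcup_k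
   (N @^-1` [set k] `&` (fun w => h k (iterate k w)) @^-1` A).
  apply/seteqP; split => w /=; first by move=> Aw; exists (N w).
  by move=> [k _ [/= <-]].
apply: bigcup_measurable => k _; apply: measurableI.
  exact: measurable_funPTI.
by rewrite -[X in measurable X]setTI; exact: mh.
Qed.

Lemma random_index_integral k : (k < K)%N ->
  (\int[P]_w ((\1_(N @^-1` [set k]) w : R) * h k (iterate k w))%:E
   = (wt k / \sum_(0 <= l < K) wt l)%:E * \int[P]_w (h k (iterate k w))%:E)%E.
Proof.
move=> kK; case: (samp) => _ _ lawN _.
(* The output index is handled as a batch of size one, whose sampling law is its own
   distribution. *)
have ind : independent_sample P (distribution P N) N (to_past xi zeta N samples).
  apply: (@independent_draw _ _ _ _ _ _ _ xi zeta N _ _ P (distribution P N)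
    (drawn Bf Bg) (fun=> inr tt) (fun=> N) 1 indep _ _ _ samples 0%N) => //.
    by move=> j [].
  by move=> [].
have mk : measurable_fun setT
    ((fun w => h k (iterate k w)) : past samples -> R).
  apply: measurable_comp1 => //.
  exact: (adapted_subset (before_samples (k := k)) (adapted_iterate k)).
pose ph (p : nat * past samples) :=
  ((\1_[set k] p.1 : R) * h k (iterate k p.2))%:E.
have mph : measurable_fun setT ph.
  apply/measurable_EFinP; apply: measurable_funM.
    have mi : measurable_fun setT (\1_[set k] : nat -> R) by exact: measurable_indic.
    exact: (measurableT_comp mi measurable_fst).
  exact: (measurableT_comp mk measurable_snd).
have := independent_ge0_integral ind mph; rewrite /ph /= => ->; last first.
  by move=> p; rewrite lee_fin mulr_ge0.
rewrite -ge0_integralZl //; last 3 first.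
- exact/measurable_EFinP.
- by move=> w _; rewrite lee_fin.
- by rewrite -lawN.
apply: eq_integral => w _.
under eq_integral do rewrite EFinM muleC.
rewrite ge0_integralZl //; last by rewrite lee_fin.
rewrite integral_indic // setIT muleC; congr (_ * _)%E; exact: lawN.
Qed.

Let W := \sum_(0 <= l < K) wt l.
Hypotheses (wt_ge0 : forall k, 0 <= wt k) (W_gt0 : 0 < W).

Let mNk k : measurable (N @^-1` [set k]).
Proof. exact: measurable_funPTI. Qed.

Let sum_indic w : \sum_(0 <= k < K) (\1_(N @^-1` [set k]) w : R) * h k (iterate k w)
  = if (N w < K)%N then h (N w) (iterate (N w) w) else 0.
Proof.
rewrite big_mkord; case: ifPn => [NK|]; last first.
  rewrite -leqNgt => KN; apply: big1 => k _.
  rewrite indicE memNset ?mul0r //= => Nk; move: KN; rewrite Nk leqNgt.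
  by rewrite (ltn_ord k).
rewrite (bigD1 (Ordinal NK)) //= big1 ?addr0 => [|k kN].
  by rewrite indicE mem_set ?mul1r.
rewrite indicE memNset ?mul0r //= => Nk; move/eqP : kN; apply.
by apply/val_inj.
Qed.

(** [sampling] prescribes the law of [N] below [K] only. These probabilities add up to one because
    [W] is nonzero, so the other values have probability zero. *)
Let N_lt_ae : {ae P, forall w, (N w < K)%N}.
Proof.
case: (samp) => _ _ lawN _.
have mK : measurable (N @^-1` `I_K) by exact: measurable_funPTI.
have PK : P (N @^-1` `I_K) = 1%E.
  rewrite -(setIT (_ @^-1` _)) -integral_indic //.
  transitivity (\int[P]_w \sum_(k <- index_iota 0 K) (\1_(N @^-1` [set k]) w : R)%:E)%E.
    apply: eq_integral => w _; rewrite sumEFin big_mkord; congr (_%:E).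
    rewrite [LHS]indicE; case: (boolP (N w < K)%N) => NK.
      rewrite mem_set // (bigD1 (Ordinal NK)) //= big1 ?addr0 => [|k kN].
        by rewrite indicE mem_set.
      rewrite indicE memNset //= => Nk; move/eqP : kN; apply.
      exact/val_inj.
    rewrite memNset //=; last exact/negP.
    rewrite big1 // => k _; rewrite indicE memNset //= => Nk.
    by move: NK; rewrite Nk ltn_ord.
  rewrite ge0_integral_sum //; last first.
    by move=> k; apply/measurable_EFinP; exact: measurable_indic.
  rewrite (eq_big_seq (fun k => (wt k / W)%:E)).
    by rewrite sumEFin -mulr_suml divff // gt_eqF.
  move=> k; rewrite mem_index_iota /= => kK.
  by rewrite integral_indic // setIT; exact: lawN.
apply: (@negligibleS _ _ _ _ (~` (N @^-1` `I_K))); first by [].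
apply/negligibleP; first exact: measurableC.
by apply: (etrans (probability_setC P mK)); rewrite PK subee.
Qed.

Lemma expectation_random_index :
  (\int[P]_w (h (N w) (iterate (N w) w))%:E
   = \int[P]_w (\sum_(0 <= k < K) wt k / W * h k (iterate k w))%:E)%E.
Proof.
have mik k : measurable_fun setT (fun w =>
    (\1_(N @^-1` [set k]) w : R) * h k (iterate k w)).
  by apply: measurable_funM => //; exact: measurable_indic.
transitivity (\int[P]_w (\sum_(0 <= k < K)
    ((\1_(N @^-1` [set k]) w : R) * h k (iterate k w)))%:E)%E.
  apply: ge0_ae_eq_integral => //.
  - exact/measurable_EFinP.
  - by apply/measurable_EFinP; exact: measurable_sum.
  - by move=> w _; rewrite lee_fin.
  - by move=> w _; rewrite lee_fin; apply: sumr_ge0 => k _; rewrite mulr_ge0.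
  - by apply: filterS N_lt_ae => w NK _; rewrite sum_indic NK.
under eq_integral do rewrite -sumEFin.
under [RHS]eq_integral do rewrite -sumEFin.
have pk0 k : 0 <= wt k / W by rewrite divr_ge0 // ltW.
have mpk k : measurable_fun setT (fun w => wt k / W * h k (iterate k w)).
  exact: measurable_funM.
rewrite !ge0_integral_sum //; first last;
  try (by move=> k; exact/measurable_EFinP);
  try (by move=> k w _; rewrite lee_fin mulr_ge0).
apply: eq_big_seq => k; rewrite mem_index_iota /= => kK.
rewrite random_index_integral //; under [RHS]eq_integral do rewrite EFinM.
rewrite ge0_integralZl ?lee_fin //; first exact/measurable_EFinP.
by move=> w _; rewrite lee_fin.
Qed.

(** The passage from pathwise estimates to expectations. All integrands are nonnegative, so
    measurability suffices and the finiteness of the left-hand side is part of the conclusion. *)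
Lemma random_iterate_bound (A : R) (a b : nat -> R) :
  0 <= A -> (forall k, 0 <= a k) -> (forall k, 0 <= b k) ->
  (forall k, 0 < Bf k)%N -> (forall k, 0 < Bg k)%N ->
  (forall w, \sum_(0 <= k < K) wt k * h k (iterate k w) <= A +
     \sum_(0 <= k < K) (a k * `|batchf k w - gradf (iterate k w)| ^+ 2
       + b k * `|batchg k w - gradg (iterate k w)| ^+ 2)) ->
  ('E_P[fun w => h (N w) (iterate (N w) w)] <=
    ((A + \sum_(0 <= k < K) (a k * (sigmaf2 / (Bf k)%:R)
       + b k * (sigmag2 / (Bg k)%:R))) / W)%:E)%E.
Proof.
move=> A0 a0 b0 Bf0 Bg0 hw; rewrite unlock expectation_random_index.
have W0 : 0 <= W^-1 by rewrite invr_ge0 ltW.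
pose ef k w := `|batchf k w - gradf (iterate k w)| ^+ 2.
pose eg k w := `|batchg k w - gradg (iterate k w)| ^+ 2.
have mef k : measurable_fun setT (ef k).
  apply: measurable_normr2; apply: strongly_measurableB.
    exact: (adapted_measurable (adapted_batchf_of (adapted_iterate k))).
  by apply: strongly_measurable_comp1 => //; exact: (adapted_measurable (adapted_iterate k)).
have meg k : measurable_fun setT (eg k).
  apply: measurable_normr2; apply: strongly_measurableB.
    exact: (adapted_measurable (adapted_batchg_of (adapted_iterate k))).
  by apply: strongly_measurable_comp1 => //; exact: (adapted_measurable (adapted_iterate k)).
have ef0 k w : 0 <= ef k w by rewrite exprn_ge0.
have eg0 k w : 0 <= eg k w by rewrite exprn_ge0.
have mab k : measurable_fun setT (fun w => a k * ef k w + b k * eg k w).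
  by apply: measurable_funD; apply: measurable_funM.
have ab0 k w : 0 <= a k * ef k w + b k * eg k w by rewrite addr_ge0 ?mulr_ge0.
apply: (@le_trans _ _ (\int[P]_w (W^-1%:E * (A + \sum_(0 <= k < K)
    (a k * ef k w + b k * eg k w))%:E))%E).
  apply: ge0_le_integral => //.
  - move=> w _; rewrite lee_fin; apply: sumr_ge0 => k _.
    by rewrite !mulr_ge0.
  - apply/measurable_EFinP; apply: measurable_sum => k.
    exact: measurable_funM.
  - apply/measurable_EFinP; apply: measurable_funM => //.
    by apply: measurable_funD => //; exact: measurable_sum.
  - move=> w _; rewrite -EFinM lee_fin.
    have -> : \sum_(0 <= k < K) wt k / W * h k (iterate k w) =
        W^-1 * \sum_(0 <= k < K) wt k * h k (iterate k w).
      by rewrite mulr_sumr; apply: eq_bigr => k _; rewrite mulrA [W^-1 * _]mulrC.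
    exact: (ler_wpM2l W0 (hw w)).
have mS : measurable_fun setT (fun w => A + \sum_(0 <= k < K)
    (a k * ef k w + b k * eg k w)).
  by apply: measurable_funD => //; exact: measurable_sum.
rewrite ge0_integralZl ?lee_fin //; first last;
  try exact/measurable_EFinP;
  try (by move=> w _; rewrite lee_fin addr_ge0 ?sumr_ge0).
rewrite mulrC EFinM; apply: lee_wpmul2l; first by rewrite lee_fin.
under eq_integral do rewrite EFinD -sumEFin.
rewrite ge0_integralD //; first last;
  try (by apply: emeasurable_sum => k; exact/measurable_EFinP);
  try exact/measurable_EFinP;
  try (by move=> w _; apply: sume_ge0 => k _; rewrite lee_fin).
rewrite integral_cst // [X in (_ * X)%E](@probability_setT _ _ _ P) mule1.
rewrite EFinD; apply: leeD => //.
rewrite ge0_integral_sum //; first last;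
  try (by move=> k; exact/measurable_EFinP);
  try (by move=> k w _; rewrite lee_fin).
rewrite -sumEFin; apply: lee_sum => k _.
under eq_integral do rewrite EFinD !EFinM.
have mefE : measurable_fun setT (EFin \o ef k) by exact/measurable_EFinP.
have megE : measurable_fun setT (EFin \o eg k) by exact/measurable_EFinP.
rewrite ge0_integralD //; first last;
  try exact: measurable_funeM;
  try (by move=> w _; rewrite -EFinM lee_fin mulr_ge0).
rewrite !ge0_integralZl ?lee_fin //; first last;
  try (by move=> w _; rewrite lee_fin).
rewrite EFinD; apply: leeD; rewrite EFinM; apply: lee_wpmul2l; rewrite ?lee_fin //.
  exact: batchf_variance.
exact: batchg_variance.
Qed.

End RandomIndex.

End Iterates.

(** * Summation along a trajectory *)

(** Two potentials appear because the Lyapunov function changes with the step size: [Q' k] is that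
    of step k after the move and [Q k.+1] that of the next step at the same point. Nonnegativity of
    [Q] is what lets the weights decrease. *)
Lemma telescoping_weighted_sum (R : realFieldType) (w Q Q' a e : nat -> R) :
  (forall k, 0 <= w k) -> (forall k, w k.+1 <= w k) -> (forall k, 0 <= Q k) ->
  (forall k, Q k.+1 <= Q' k) -> (forall k, Q' k + a k <= Q k + e k) ->
  forall K, \sum_(0 <= k < K) w k * a k <=
    w 0%N * Q 0%N + \sum_(0 <= k < K) w k * e k.
Proof.
move=> w0 wS Q0 QS step K.
suff : \sum_(0 <= k < K) w k * a k + w K * Q K <=
    w 0%N * Q 0%N + \sum_(0 <= k < K) w k * e k.
  by apply: le_trans; rewrite lerDl mulr_ge0.
elim: K => [|K IH]; first by rewrite !big_geq // add0r addr0.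
rewrite !big_nat_recr //=.
have h1 : w K.+1 * Q K.+1 <= w K * Q' K by apply: ler_pM.
have := ler_wpM2l (w0 K) (step K); lra.
Qed.

Section Trajectory.
Variables (R : realType) (H : completeNormedModType R).
Variables (ip : {dot H for idfun}).
Hypothesis hip : hilbert_norm ip.
Variables (f g : H -> R) (gradf gradg : H -> H) (Lf Lg G finf gmin : R).
Hypotheses (df : forall x, is_gradient ip f x (gradf x))
  (lipf : Lf.-lipschitz gradf)
  (dg : forall x, is_gradient ip g x (gradg x))
  (lipg : Lg.-lipschitz gradg)
  (gradf_le : forall x, `|gradf x| <= G)
  (f_ge : forall x, finf <= f x) (g_ge : forall x, gmin <= g x).
Hypothesis Lg_gt0 : 0 < Lg.

(* [n] is the clock ([K] or [k + 1]) and [p = n ^ a]. *)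
Variables (ce cb cr : R) (n p : nat -> R).
Hypotheses (ce_gt0 : 0 < ce) (cb_gt0 : 0 < cb) (cr_gt0 : 0 < cr).
Hypotheses (p_ge1 : forall k, 1 <= p k) (p3_le : forall k, p k ^+ 3 <= n k)
  (p_mono : forall k, p k <= p k.+1)
  (beta_mono : forall k, p k.+1 ^+ 3 / n k.+1 <= p k ^+ 3 / n k).

Let eta k := ce / p k.
Let beta k := cb * (p k ^+ 3 / n k).
Let r k := cr * (p k / n k).
Let rho k := r k ^+ 2.

Hypotheses (eta_Lf : forall k, eta k * Lf <= 1 / 2)
  (eta_Lg : forall k, 4 * Lg * eta k <= 1) (beta_le1 : forall k, beta k <= 1).

Variables (x u v : nat -> H).
Hypothesis xS : forall k,
  x k.+1 = x k - eta k *: direction ip (beta k) (rho k) (u k) (v k).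

Let ef k := `|u k - gradf (x k)| ^+ 2.
Let eg k := `|v k - gradg (x k)| ^+ 2.

Let p_gt0 k : 0 < p k. Proof. exact: lt_le_trans ltr01 (p_ge1 k). Qed.
Let p3_ge1 k : 1 <= p k ^+ 3. Proof. exact: exprn_ege1. Qed.
Let n_ge1 k : 1 <= n k. Proof. exact: le_trans (p3_ge1 k) (p3_le k). Qed.
Let n_gt0 k : 0 < n k. Proof. exact: lt_le_trans ltr01 (n_ge1 k). Qed.
Let p_le_n k : p k <= n k.
Proof.
by apply: le_trans (p3_le k); rewrite -{1}[p k]expr1 ler_weXn2l.
Qed.
Let eta_gt0 k : 0 < eta k. Proof. exact: divr_gt0. Qed.
Let beta_gt0 k : 0 < beta k.
Proof. by rewrite mulr_gt0 // divr_gt0 ?exprn_gt0. Qed.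
Let r_gt0 k : 0 < r k. Proof. by rewrite mulr_gt0 // divr_gt0. Qed.
Let rho_gt0 k : 0 < rho k. Proof. exact: exprn_gt0. Qed.
Let eta_mono k : eta k.+1 <= eta k.
Proof. by rewrite ler_pM2l // lef_pV2 ?posrE. Qed.

(** The initial Lyapunov value, shifted by the lower bounds. It has [ce] in place of the smaller
    [eta 0], so that it does not depend on the horizon. *)
Definition lyapunov0 : R := g (x 0) - gmin + 2 * Lg * ce * (f (x 0) - finf).

(** The deterministic loss of one step in units of 1/n: [eta * r] and [eta^3 * beta] are exact
    multiples of 1/n, and the two terms containing [rho] are smaller since p^4 <= n^2 and p <= n. *)
Definition drift : R :=
  ce * cb * cr ^+ 2 + ce * G * cr / 2 + ce * cr ^+ 2 / 4
  + 8 * Lg ^+ 2 * G ^+ 2 * ce ^+ 3 * cb.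

Let drift_le k :
  eta k * (beta k * rho k + G * r k / 2 + rho k / 4)
    + 8 * Lg ^+ 2 * G ^+ 2 * eta k ^+ 3 * beta k <= drift / n k.
Proof.
have n0 := n_gt0 k; have p0 := p_gt0 k; have q0 := gt_eqF n0; have q1 := gt_eqF p0.
have -> : eta k * (beta k * rho k + G * r k / 2 + rho k / 4)
    + 8 * Lg ^+ 2 * G ^+ 2 * eta k ^+ 3 * beta k =
  (ce * cb * cr ^+ 2 * (p k ^+ 4 / n k ^+ 2) + ce * G * cr / 2
   + ce * cr ^+ 2 / 4 * (p k / n k)
   + 8 * Lg ^+ 2 * G ^+ 2 * ce ^+ 3 * cb) / n k.
  by rewrite /eta /beta /rho /r; field; rewrite q0 q1.
have pn : p k / n k <= 1 by rewrite ler_pdivrMr // mul1r.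
have pn0 : 0 <= p k / n k by rewrite divr_ge0 // ltW.
have p4n : p k ^+ 4 / n k ^+ 2 <= 1.
  rewrite (_ : _ / _ = (p k ^+ 3 / n k) * (p k / n k)); last by field; rewrite q0.
  by rewrite mulr_ile1 ?divr_ge0 ?exprn_ge0 ?(ltW p0) ?(ltW n0)// ler_pdivrMr // mul1r.
have c1 : 0 <= ce * cb * cr ^+ 2 by rewrite !mulr_ge0 ?exprn_ge0 // ltW.
have c2 : 0 <= ce * cr ^+ 2 / 4 by rewrite !mulr_ge0 ?exprn_ge0 // ltW.
rewrite ler_pM2r ?invr_gt0 // /drift.
have := ler_piMr c1 p4n; have := ler_piMr c2 pn; lra.
Qed.

(** Used with weight 1 for the gradient of [g], and with weights above p^4/n for the direction. *)
Lemma sum_barrier_estimate (w : nat -> R) (K : nat) :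
  (forall k, 0 <= w k) -> (forall k, w k.+1 <= w k) ->
  \sum_(0 <= k < K) w k * (eta k * beta k * `|v k| ^+ 2) <=
  4 * (w 0%N * lyapunov0) + \sum_(0 <= k < K) w k *
    (4 * drift / n k + 8 * eta k * ef k + 2 / Lg * eg k).
Proof.
move=> w0 wS.
(* Subtracting the lower bounds makes the potential nonnegative and nondecreasing in [e], so a
   decrease of the step size only lowers it. *)
pose Psi (e : R) y := g y - gmin + 2 * Lg * e * (f y - finf).
have F0 y : 0 <= f y - finf by rewrite subr_ge0.
have G0 y : 0 <= g y - gmin by rewrite subr_ge0.
have := @telescoping_weighted_sum R w (fun k => Psi (eta k) (x k))
  (fun k => Psi (eta k) (x k.+1)) (fun k => eta k * beta k * `|v k| ^+ 2 / 4)
  (fun k => drift / n k + 2 * eta k * ef k + eg k / (2 * Lg)) w0 wS.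
have Psi_mono e e' y : e <= e' -> Psi e y <= Psi e' y.
  by move=> ee'; rewrite /Psi lerD2l ler_wpM2r // ler_wpM2l // mulr_ge0 // ltW.
move=> /(_ _ _ _ K) h.
have {}h : \sum_(0 <= k < K) w k * (eta k * beta k * `|v k| ^+ 2 / 4) <=
    w 0%N * lyapunov0 + \sum_(0 <= k < K) w k *
      (drift / n k + 2 * eta k * ef k + eg k / (2 * Lg)).
  apply: le_trans (h _ _ _) _.
  - move=> k; rewrite /Psi addr_ge0 //; apply: mulr_ge0 => //.
    by apply: mulr_ge0; [rewrite mulr_ge0 // ltW|exact: ltW].
  - by move=> k; exact: Psi_mono.
  - move=> k; rewrite /Psi xS.
    have := lyapunov_step hip (x k) (u k) (v k) df lipf dg lipg gradf_le
      (eta_gt0 k) Lg_gt0 (eta_Lf k) (eta_Lg k) (ltW (beta_gt0 k)) (beta_le1 k)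
      (r_gt0 k) (erefl (rho k)).
    have := drift_le k; rewrite /= /ef /eg; lra.
  - rewrite lerD2r ler_wpM2l //; apply: Psi_mono.
    by rewrite ler_pdivrMr // ler_peMr // (ltW ce_gt0).
have {}h := ler_wpM2l (ler0n R 4) h.
rewrite mulr_sumr mulrDr mulr_sumr in h.
have E1 : \sum_(0 <= k < K) w k * (eta k * beta k * `|v k| ^+ 2) =
    \sum_(0 <= k < K) 4 * (w k * (eta k * beta k * `|v k| ^+ 2 / 4)).
  by apply: eq_bigr => k _; field.
have E2 : \sum_(0 <= k < K) w k * (4 * drift / n k + 8 * eta k * ef k + 2 / Lg * eg k)
   = \sum_(0 <= k < K) 4 * (w k * (drift / n k + 2 * eta k * ef k + eg k / (2 * Lg))).
  by apply: eq_bigr => k _; field; rewrite !gt_eqF.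
by rewrite E1 E2.
Qed.

Lemma sum_gradg (K : nat) :
  \sum_(0 <= k < K) eta k * beta k * `|gradg (x k)| ^+ 2 <=
  8 * (lyapunov0 + drift * \sum_(0 <= k < K) (n k)^-1) + \sum_(0 <= k < K)
    (16 * eta k * ef k + (4 / Lg + 2 * (ce * cb)) * eg k).
Proof.
have := @sum_barrier_estimate (fun=> 1) K (fun=> ler01) (fun=> lexx 1).
move=> /(ler_wpM2l (ler0n R 2)); rewrite mulr_sumr mulrDr mulr_sumr => h.
have eb k : eta k * beta k <= ce * cb.
  apply: ler_pM; rewrite ?(ltW (eta_gt0 k)) ?(ltW (beta_gt0 k)) //.
    by rewrite ler_pdivrMr // ler_peMr // ltW.
  by rewrite ler_piMr ?(ltW cb_gt0)// ler_pdivrMr // mul1r.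
have h2 : \sum_(0 <= k < K) eta k * beta k * `|gradg (x k)| ^+ 2 <=
  \sum_(0 <= k < K) 2 * (1 * (eta k * beta k * `|v k| ^+ 2)) +
  \sum_(0 <= k < K) 2 * (ce * cb) * eg k.
  rewrite -big_split /=; apply: ler_sum => k _.
  have k1 : `|gradg (x k)| ^+ 2 <= 2 * `|v k| ^+ 2 + 2 * eg k.
    have := ler_normB (v k) (v k - gradg (x k)); rewrite subKr => tri.
    have : `|gradg (x k)| ^+ 2 <= (`|v k| + `|v k - gradg (x k)|) ^+ 2.
      by rewrite ler_pXn2r ?nnegrE ?addr_ge0.
    by have := sqr_ge0 (`|v k| - `|v k - gradg (x k)|); rewrite /eg; lra.
  have k2 := ler_wpM2l (ltW (mulr_gt0 (eta_gt0 k) (beta_gt0 k))) k1.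
  have k3 : eta k * beta k * eg k <= ce * cb * eg k.
    by rewrite ler_wpM2r // exprn_ge0.
  lra.
apply: le_trans h2 _; apply: le_trans (lerD h (lexx _)) _.
rewrite le_eqVlt; apply/orP; left; apply/eqP.
move: lyapunov0 drift => L0 dr.
rewrite -addrA -big_split /= mulr_sumr mulrDr mulr_sumr -addrA -big_split /=.
congr (_ + _); first by ring.
by apply: eq_bigr => k _; field; rewrite !gt_eqF.
Qed.

(** Chosen so that 5 beta^2 + 4 beta/eta <= 2 * coupling * (p^4/n), which is the factor of eta beta
    |v|^2 left by the descent of [f]. *)
Definition coupling : R := 5 / 2 * (cb * cb) + 2 * (cb / ce).

(** The descent of [f] is telescoped with weights beta, and the |v| terms that it leaves are charged
    to [sum_barrier_estimate]. The required weight p^4/n need not be monotone, hence the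
    nonincreasing majorant [w]. *)
Lemma sum_direction (w : nat -> R) (K : nat) :
  (forall k, 0 <= w k) -> (forall k, w k.+1 <= w k) ->
  (forall k, (k < K)%N -> p k ^+ 4 / n k <= w k) ->
  \sum_(0 <= k < K) eta k * beta k *
     `|direction ip (beta k) (rho k) (gradf (x k)) (gradg (x k))| ^+ 2 <=
  4 * cb * (f (x 0) - finf) * (p 0%N ^+ 3 / n 0%N)
  + G ^+ 2 * (ce * cb) ^+ 2 * \sum_(0 <= k < K) p k ^+ 4 / n k ^+ 2
  + 8 * coupling * (w 0%N * lyapunov0 + drift * \sum_(0 <= k < K) w k / n k)
  + \sum_(0 <= k < K)
     ((24 * (eta k * beta k) + 16 * coupling * (w k * eta k)) * ef k
      + (eta k * beta k * (72 * beta k ^+ 2 + 8 * G ^+ 2 / rho k)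
         + 4 * coupling / Lg * w k) * eg k).
Proof.
move=> w0 wS pw.
have F0 k : 0 <= f (x k) - finf by rewrite subr_ge0.
have beta_mono' k : beta k.+1 <= beta k by rewrite ler_pM2l.
pose d k := direction ip (beta k) (rho k) (u k) (v k).
have := @telescoping_weighted_sum R beta (fun k => f (x k) - finf)
  (fun k => f (x k.+1) - finf) (fun k => eta k * `|d k| ^+ 2 / 2)
  (fun k => eta k * (2 * ef k + 5 / 4 * beta k ^+ 2 * `|v k| ^+ 2
                 + beta k * G * `|v k|)) (fun k => ltW (beta_gt0 k)) beta_mono' F0
  (fun k => lexx _).
have step k : f (x k.+1) - finf + eta k * `|d k| ^+ 2 / 2 <= f (x k) - finf +
    eta k * (2 * ef k + 5 / 4 * beta k ^+ 2 * `|v k| ^+ 2 + beta k * G * `|v k|).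
  have := descent_upper hip (x k) (u k) (v k) df lipf gradf_le (eta_gt0 k)
    (eta_Lf k) (ltW (beta_gt0 k)) (rho_gt0 k).
  by rewrite xS /= /ef; lra.
move=> /(_ step K)/(ler_wpM2l (ler0n R 4)) h1.
rewrite [leLHS]mulr_sumr mulrDr [4 * \sum_(_ <= _ < _) _]mulr_sumr in h1.
have h2 := sum_barrier_estimate K w0 wS.
have cpl0 : 0 <= coupling.
  by rewrite addr_ge0 // !mulr_ge0 ?invr_ge0 // ltW.
move: h2 cpl0; move cE : coupling => c; move: lyapunov0 drift => L0 dr h2 cpl0.
have {}h2 := ler_wpM2l (mulr_ge0 (ler0n R 2) cpl0) h2.
rewrite mulr_sumr mulrDr mulr_sumr in h2.
have eb0 k : 0 <= eta k * beta k by exact/ltW/mulr_gt0.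
have term k : (k < K)%N -> eta k * beta k *
     `|direction ip (beta k) (rho k) (gradf (x k)) (gradg (x k))| ^+ 2 <=
  4 * (beta k * (eta k * `|d k| ^+ 2 / 2))
  + eta k * beta k * (16 * ef k + (72 * beta k ^+ 2 + 8 * G ^+ 2 / rho k) * eg k).
  move=> kK.
  have := direction_error hip (ltW (beta_gt0 k)) (r_gt0 k) (erefl (rho k))
    (u k) (v k) (gradg (x k)) (gradf_le (x k)).
  by move=> /(ler_wpM2l (eb0 k)); rewrite -/(d k) /ef /eg; lra.
have cross k : (k < K)%N ->
  4 * (beta k * (eta k * (2 * ef k + 5 / 4 * beta k ^+ 2 * `|v k| ^+ 2
                 + beta k * G * `|v k|))) <=
  8 * (eta k * beta k) * ef k + G ^+ 2 * (ce * cb) ^+ 2 * (p k ^+ 4 / n k ^+ 2)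
  + 2 * c * (w k * (eta k * beta k * `|v k| ^+ 2)).
  move=> kK.
  have n0 := n_gt0 k; have p0 := p_gt0 k; have q0 := gt_eqF n0; have q1 := gt_eqF p0.
  (* Young's inequality, weighted so that after multiplication by eta beta the term free of |v| is
     G^2 (eta beta)^2, of order p^4/n^2. *)
  have y1 : 4 * beta k * G * `|v k| <= 4 * (beta k / eta k) * `|v k| ^+ 2
      + eta k * beta k * G ^+ 2.
    have bE : 0 <= beta k / eta k by rewrite divr_ge0 ?(ltW (beta_gt0 k)) ?(ltW (eta_gt0 k)).
    have := mulr_ge0 bE (sqr_ge0 (2 * `|v k| - eta k * G)).
    have -> : beta k / eta k * (2 * `|v k| - eta k * G) ^+ 2 =
      4 * (beta k / eta k) * `|v k| ^+ 2 + eta k * beta k * G ^+ 2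
      - 4 * beta k * G * `|v k| by field; rewrite gt_eqF.
    lra.
  have y2 : 5 * beta k ^+ 2 + 4 * (beta k / eta k) <= 2 * c * w k.
    have bE : beta k / eta k = cb / ce * (p k ^+ 4 / n k).
      by rewrite /beta /eta; field; rewrite q0 q1 gt_eqF.
    have b2 : beta k ^+ 2 <= cb * cb * (p k ^+ 4 / n k).
      rewrite (_ : beta k ^+ 2 = cb * cb * (p k ^+ 4 / n k * (p k ^+ 2 / n k))); last first.
        by rewrite /beta; field; rewrite q0.
      rewrite ler_wpM2l ?mulr_ge0 ?(ltW cb_gt0)//.
      rewrite ler_piMr ?divr_ge0 ?exprn_ge0 ?(ltW p0) ?(ltW n0)//.
      by rewrite ler_pdivrMr // mul1r (le_trans _ (p3_le k)) // ler_weXn2l.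
    have := ler_wpM2l cpl0 (pw k kK); rewrite -cE /coupling bE in b2 *; lra.
  have y3 : eta k * beta k * (eta k * beta k) = (ce * cb) ^+ 2 * (p k ^+ 4 / n k ^+ 2).
    by rewrite /beta /eta; field; rewrite q0 q1.
  have := ler_wpM2l (eb0 k) y1.
  have := ler_wpM2l (mulr_ge0 (eb0 k) (sqr_ge0 `|v k|)) y2.
  have -> : eta k * beta k * (4 * (beta k / eta k) * `|v k| ^+ 2 + eta k * beta k * G ^+ 2)
    = eta k * beta k * `|v k| ^+ 2 * (4 * (beta k / eta k))
      + eta k * beta k * (eta k * beta k) * G ^+ 2 by ring.
  rewrite y3; lra.
have s1 : \sum_(0 <= k < K) eta k * beta k *
     `|direction ip (beta k) (rho k) (gradf (x k)) (gradg (x k))| ^+ 2 <=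
  \sum_(0 <= k < K) 4 * (beta k * (eta k * `|d k| ^+ 2 / 2)) +
  \sum_(0 <= k < K) eta k * beta k *
     (16 * ef k + (72 * beta k ^+ 2 + 8 * G ^+ 2 / rho k) * eg k).
  by rewrite -big_split /=; apply: ler_sum_nat => k /andP[_ kK]; exact: term.
have s2 : \sum_(0 <= k < K) 4 * (beta k * (eta k * (2 * ef k
      + 5 / 4 * beta k ^+ 2 * `|v k| ^+ 2 + beta k * G * `|v k|))) <=
  \sum_(0 <= k < K) 8 * (eta k * beta k) * ef k
  + \sum_(0 <= k < K) G ^+ 2 * (ce * cb) ^+ 2 * (p k ^+ 4 / n k ^+ 2)
  + \sum_(0 <= k < K) 2 * c * (w k * (eta k * beta k * `|v k| ^+ 2)).
  by rewrite -!big_split /=; apply: ler_sum_nat => k /andP[_ kK]; exact: cross.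
apply: (@le_trans _ _ (4 * (beta 0%N * (f (x 0) - finf)) +
  (\sum_(0 <= k < K) 8 * (eta k * beta k) * ef k
  + \sum_(0 <= k < K) G ^+ 2 * (ce * cb) ^+ 2 * (p k ^+ 4 / n k ^+ 2)
  + (2 * c * (4 * (w 0%N * L0)) +
     \sum_(0 <= k < K) 2 * c * (w k *
        (4 * dr / n k + 8 * eta k * ef k + 2 / Lg * eg k)))) +
  \sum_(0 <= k < K) eta k * beta k *
     (16 * ef k + (72 * beta k ^+ 2 + 8 * G ^+ 2 / rho k) * eg k))).
  by move: s1 s2 h1 h2; lra.
rewrite le_eqVlt; apply/orP; left; apply/eqP.
rewrite -mulr_sumr [dr * _]mulr_sumr.
have -> : \sum_(0 <= k < K) 2 * c * (w k *
        (4 * dr / n k + 8 * eta k * ef k + 2 / Lg * eg k)) =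
   8 * c * \sum_(0 <= k < K) dr * (w k / n k) +
   \sum_(0 <= k < K) (16 * c * (w k * eta k) * ef k
     + 4 * c / Lg * w k * eg k).
  rewrite mulr_sumr -big_split /=; apply: eq_bigr => k _.
  by field; rewrite !gt_eqF.
have -> : \sum_(0 <= k < K)
     ((24 * (eta k * beta k) + 16 * c * (w k * eta k)) * ef k
      + (eta k * beta k * (72 * beta k ^+ 2 + 8 * G ^+ 2 / rho k)
         + 4 * c / Lg * w k) * eg k) =
  \sum_(0 <= k < K) 8 * (eta k * beta k) * ef k +
  \sum_(0 <= k < K) (16 * c * (w k * eta k) * ef k
     + 4 * c / Lg * w k * eg k) +
  \sum_(0 <= k < K) eta k * beta k *
     (16 * ef k + (72 * beta k ^+ 2 + 8 * G ^+ 2 / rho k) * eg k).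
  by rewrite -!big_split /=; apply: eq_bigr => k _; ring.
rewrite {1}/beta; ring.
Qed.

End Trajectory.

(** * Convergence rates *)

Section Rates.
Variables (R : realType) (H : completeNormedModType R).
Variables (ip : {dot H for idfun}).
Hypothesis hip : hilbert_norm ip.
Context {df dg : measure_display}.
Context {Sf : measurableType df} {Sg : measurableType dg}.
Variables (Pf : probability Sf R) (Pg : probability Sg R).
Variables (F : Sf -> H -> R) (gradF : Sf -> H -> H) (f : H -> R) (gradf : H -> H).
Variables (G : Sg -> H -> R) (gradG : Sg -> H -> H) (g : H -> R) (gradg : H -> H).
Variables (Lf Lg Gf sigmaf2 sigmag2 : R).
Hypotheses (Lg_gt0 : 0 < Lg) (Gf_gt0 : 0 < Gf)
  (sigmaf2_ge0 : 0 <= sigmaf2) (sigmag2_ge0 : 0 <= sigmag2).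
Hypotheses (hf : stochastic_objective ip Pf F gradF f gradf Lf sigmaf2)
  (hg : stochastic_objective ip Pg G gradG g gradg Lg sigmag2)
  (gradf_bounded : forall x, `|gradf x| <= Gf).
Variables (finf gmin : R).
Hypotheses (f_ge : forall x, finf <= f x) (g_ge : forall x, gmin <= g x).
Variables (x0 : H).
Variables (ce cb cr CF CG : R).
Hypotheses (ce_gt0 : 0 < ce) (cb_gt0 : 0 < cb) (cr_gt0 : 0 < cr)
  (CF_gt0 : 0 < CF) (CG_gt0 : 0 < CG).

Let L0 : R := g x0 - gmin + 2 * Lg * ce * (f x0 - finf).
Let dr : R := drift Lg Gf ce cb cr.
Let cpl : R := coupling ce cb.

(** It sees the schedule only through proportionality constants, so it is independent of the
    horizon. The division by [ce * cb] comes from the total weight [ce * cb * V]. *)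
Definition gradg_constant : R :=
  (8 * L0 + 8 * dr + 16 * ce * CF * sigmaf2 + (4 / Lg + 2 * (ce * cb)) * CG * sigmag2)
  / (ce * cb).

Definition direction_constant : R :=
  (4 * cb * (f x0 - finf) + Gf ^+ 2 * (ce * cb) ^+ 2 + 8 * cpl * (L0 + dr)
   + sigmaf2 * CF * (24 * (ce * cb) + 16 * cpl * ce)
   + sigmag2 * CG * (ce * cb * (72 * cb ^+ 2 + 8 * Gf ^+ 2 / cr ^+ 2) + 4 * cpl / Lg))
  / (ce * cb).

Let L0_ge0 : 0 <= L0.
Proof. by rewrite addr_ge0 ?subr_ge0 // !mulr_ge0 ?subr_ge0 // ltW. Qed.

Let dr_ge0 : 0 <= dr.
Proof.
rewrite /dr /drift !addr_ge0 // !mulr_ge0 ?exprn_ge0 ?invr_ge0 //.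
all: exact: ltW.
Qed.

Let cpl_ge0 : 0 <= cpl.
Proof. by rewrite addr_ge0 // !mulr_ge0 ?invr_ge0 // ltW. Qed.

Let cecb_gt0 : 0 < ce * cb. Proof. exact: mulr_gt0. Qed.

Lemma gradg_constant_ge0 : 0 <= gradg_constant.
Proof.
rewrite divr_ge0 ?(ltW cecb_gt0) // !addr_ge0 // !mulr_ge0 //.
all: rewrite ?addr_ge0 ?mulr_ge0 ?invr_ge0 //; exact: ltW.
Qed.

Lemma direction_constant_ge0 : 0 <= direction_constant.
Proof.
have f0 : 0 <= f x0 - finf by rewrite subr_ge0.
have cr2 : 0 <= 8 * Gf ^+ 2 / cr ^+ 2.
  by rewrite divr_ge0 ?mulr_ge0 ?exprn_ge0 // ltW.
have cL : 0 <= 4 * cpl / Lg by rewrite divr_ge0 ?mulr_ge0 // ltW.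
rewrite divr_ge0 ?(ltW cecb_gt0) // !addr_ge0 //.
- by rewrite !mulr_ge0 // ltW.
- by rewrite mulr_ge0 // exprn_ge0 // ltW.
- by rewrite !mulr_ge0 // addr_ge0.
- by rewrite !mulr_ge0 ?(ltW CF_gt0) // addr_ge0 // !mulr_ge0 // ltW.
- rewrite !mulr_ge0 ?(ltW CG_gt0) // addr_ge0 // mulr_ge0 ?(ltW cecb_gt0) //.
  by rewrite addr_ge0 // mulr_ge0 // exprn_ge0 // ltW.
Qed.

Variables (n p : nat -> R) (Bf Bg : nat -> nat).
Hypotheses (p_ge1 : forall k, 1 <= p k) (p3_le : forall k, p k ^+ 3 <= n k)
  (p_mono : forall k, p k <= p k.+1)
  (beta_mono : forall k, p k.+1 ^+ 3 / n k.+1 <= p k ^+ 3 / n k).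

Let eta k := ce / p k.
Let beta k := cb * (p k ^+ 3 / n k).
Let rho k := (cr * (p k / n k)) ^+ 2.

Hypotheses (eta_Lf : forall k, eta k * Lf <= 1 / 2)
  (eta_Lg : forall k, 4 * Lg * eta k <= 1) (beta_le1 : forall k, beta k <= 1).
Hypotheses (Bf_gt0 : forall k, (0 < Bf k)%N) (Bg_gt0 : forall k, (0 < Bg k)%N)
  (Bf_le : forall k, (Bf k)%:R^-1 <= CF * (p k ^+ 4 / n k ^+ 2))
  (Bg_le : forall k, (Bg k)%:R^-1 <= CG * (p k ^+ 6 / n k ^+ 4)).
Variable K : nat.
Hypothesis K_gt0 : (0 < K)%N.

Context {dO : measure_display} {Omega : measurableType dO}.
Variables (P : probability Omega R) (xi : nat -> nat -> {mfun Omega >-> Sf})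
  (zeta : nat -> nat -> {mfun Omega >-> Sg}) (N : {mfun Omega >-> nat}).
Hypothesis samp :
  sampling P Pf Pg Bf Bg (fun k => eta k * beta k) K xi zeta N.

Let x k w := sdbgd ip gradF gradG eta beta rho Bf Bg x0
  (fun l i => xi l i w) (fun l j => zeta l j w) k.

Let p_gt0 k : 0 < p k. Proof. exact: lt_le_trans ltr01 (p_ge1 k). Qed.
Let n_ge1 k : 1 <= n k.
Proof. by apply: le_trans (p3_le k); exact: exprn_ege1. Qed.
Let n_gt0 k : 0 < n k. Proof. exact: lt_le_trans ltr01 (n_ge1 k). Qed.
Let eta_gt0 k : 0 < eta k. Proof. exact: divr_gt0. Qed.
Let beta_gt0 k : 0 < beta k.
Proof. by rewrite mulr_gt0 // divr_gt0 ?exprn_gt0. Qed.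
Let rho_gt0 k : 0 < rho k.
Proof. by rewrite exprn_gt0 // mulr_gt0 // divr_gt0. Qed.

Let wtE k : eta k * beta k = ce * cb * (p k ^+ 2 / n k).
Proof. by rewrite /eta /beta; field; rewrite !gt_eqF. Qed.

Let p2_le k : p k ^+ 2 <= n k.
Proof. by apply: le_trans (p3_le k); rewrite ler_weXn2l. Qed.

Let V := \sum_(0 <= k < K) p k ^+ 2 / n k.

Let V_gt0 : 0 < V.
Proof.
rewrite /V -(prednK K_gt0) big_nat_recr //= ltr_wpDl //.
  by apply: sumr_ge0 => k _; rewrite divr_ge0 ?exprn_ge0 // ltW.
by rewrite divr_gt0 // exprn_gt0.
Qed.

Let wt_sum : \sum_(0 <= k < K) eta k * beta k = ce * cb * V.
Proof. by rewrite mulr_sumr; apply: eq_bigr => k _; exact: wtE. Qed.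

Let t_le1 k : p k ^+ 2 / n k <= 1. Proof. by rewrite ler_pdivrMr // mul1r. Qed.
Let s_le1 k : p k ^+ 3 / n k <= 1. Proof. by rewrite ler_pdivrMr // mul1r. Qed.
Let t_ge0 k : 0 <= p k ^+ 2 / n k.
Proof. by rewrite divr_ge0 ?exprn_ge0 // ltW. Qed.
Let s_ge0 k : 0 <= p k ^+ 3 / n k.
Proof. by rewrite divr_ge0 ?exprn_ge0 // ltW. Qed.
Let ninv_ge0 k : 0 <= (n k)^-1. Proof. by rewrite invr_ge0 ltW. Qed.
Let ninv_le1 k : (n k)^-1 <= 1. Proof. by rewrite invf_le1. Qed.

(** Puts the noise of the [f] batch on the same scale 1/n as the drift; [Bg_n] does so for [g]. *)
Let eta_Bf k : eta k / (Bf k)%:R <= ce * CF / n k.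
Proof.
apply: le_trans (ler_wpM2l (ltW (eta_gt0 k)) (Bf_le k)) _.
rewrite (_ : eta k * _ = ce * CF / n k * (p k ^+ 3 / n k)); last first.
  by rewrite /eta; field; rewrite !gt_eqF.
by rewrite ler_piMr // divr_ge0 ?mulr_ge0 // ltW.
Qed.

Let Bg_n k : (Bg k)%:R^-1 <= CG / n k.
Proof.
apply: le_trans (Bg_le k) _.
rewrite (_ : CG * _ = CG / n k * ((p k ^+ 3 / n k) ^+ 2 * (n k)^-1)); last first.
  by field; rewrite gt_eqF.
rewrite ler_piMr ?divr_ge0 ?(ltW CG_gt0) ?(ltW (n_gt0 k))//.
by rewrite mulr_ile1 // ?exprn_ge0 // exprn_ile1.
Qed.

Let ebb k : eta k * beta k / (Bf k)%:R <= ce * cb * CF * (p k ^+ 4 / n k ^+ 2).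
Proof.
rewrite wtE; apply: le_trans (ler_wpM2l _ (Bf_le k)) _.
  by rewrite mulr_ge0 // ltW.
rewrite [leLHS](_ : _ = ce * cb * CF * (p k ^+ 4 / n k ^+ 2) * (p k ^+ 2 / n k)); last first.
  by field; rewrite gt_eqF.
by rewrite ler_piMr // !mulr_ge0 ?invr_ge0 ?exprn_ge0 // ltW.
Qed.

(** Up to constants, the bound on 1/Bg is [rho] times the one on 1/Bf. This cancels the 1/rho in the
    squared Lipschitz constant of the direction. *)
Let ebg k : eta k * beta k * (72 * beta k ^+ 2 + 8 * Gf ^+ 2 / rho k) / (Bg k)%:R
  <= ce * cb * (72 * cb ^+ 2 + 8 * Gf ^+ 2 / cr ^+ 2) * CG * (p k ^+ 4 / n k ^+ 2).
Proof.
have q0 := gt_eqF (n_gt0 k); have q1 := gt_eqF (p_gt0 k).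
have c1 : 0 <= ce * cb * (72 * cb ^+ 2) * CG * (p k ^+ 4 / n k ^+ 2).
  by rewrite !mulr_ge0 ?invr_ge0 ?exprn_ge0 // ltW.
have c2 : 0 <= ce * cb * (8 * Gf ^+ 2 / cr ^+ 2) * CG * (p k ^+ 4 / n k ^+ 2).
  by rewrite !mulr_ge0 ?invr_ge0 ?exprn_ge0 // ltW.
have m0 : 0 <= eta k * beta k * (72 * beta k ^+ 2 + 8 * Gf ^+ 2 / rho k).
  rewrite mulr_ge0 ?(ltW (mulr_gt0 (eta_gt0 k) (beta_gt0 k)))// addr_ge0 //.
    by rewrite mulr_ge0 ?sqr_ge0.
  by rewrite divr_ge0 ?(ltW (rho_gt0 k)) // mulr_ge0 ?sqr_ge0.
apply: le_trans (ler_wpM2l m0 (Bg_le k)) _.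
rewrite wtE [leLHS](_ : _ = ce * cb * (72 * cb ^+ 2) * CG * (p k ^+ 4 / n k ^+ 2)
    * (p k ^+ 2 / n k) ^+ 5 + ce * cb * (8 * Gf ^+ 2 / cr ^+ 2) * CG *
    (p k ^+ 4 / n k ^+ 2) * (p k ^+ 2 / n k)); last first.
  by rewrite /beta /rho; field; rewrite q0 q1 gt_eqF.
have := ler_piMr c1 (exprn_ile1 5 (t_ge0 k) (t_le1 k)).
have := ler_piMr c2 (t_le1 k); lra.
Qed.

Let ler_ratio (X Y Z c W : R) : 0 < c -> 0 < W -> X <= Y * Z ->
  X / (c * W) <= Y / c * Z / W.
Proof.
move=> c0 W0 XYZ.
rewrite (_ : Y / c * Z / W = Y * Z / (c * W)); last by field; rewrite !gt_eqF.
by rewrite ler_wpM2r // invr_ge0 mulr_ge0 // ltW.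
Qed.

Lemma gradg_rate :
  ('E_P[fun w => (`|gradg (x (N w) w)| ^+ 2)%R] <=
   (gradg_constant * (1 + \sum_(0 <= k < K) (n k)^-1) / V)%:E)%E.
Proof.
have cg : seq_continuous ((fun _ y => `|gradg y| ^+ 2) 0%N : H -> R^o).
  move=> y z yz; apply: (@cvgM _ _ _ _ (fun n => `|gradg (y n)|) (fun n => `|gradg (y n)|));
    by apply: cvg_norm; exact: (lipschitz_seq_continuous (gradient_lipschitz hg)).
have W0 : 0 < \sum_(0 <= l < K) eta l * beta l by rewrite wt_sum mulr_gt0.
have S0 : 0 <= \sum_(0 <= k < K) (n k)^-1 by apply: sumr_ge0.
have b0 : 0 <= 4 / Lg + 2 * (ce * cb) by rewrite addr_ge0 ?divr_ge0 ?mulr_ge0 // ltW.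
apply: le_trans (@random_iterate_bound _ _ ip hip _ _ _ _ _ _ P Pf Pg _ _ _ _
  _ _ _ _ _ _ _ _ hf hg eta beta rho Bf Bg x0 rho_gt0 (fun k => eta k * beta k) K
  xi zeta N samp (fun _ y => `|gradg y| ^+ 2) (fun=> cg) _ _ W0
  (8 * (L0 + dr * \sum_(0 <= k < K) (n k)^-1)) (fun k => 16 * eta k)
  (fun=> 4 / Lg + 2 * (ce * cb)) _ _ _ Bf_gt0 Bg_gt0 _) _.
- by move=> k y; rewrite exprn_ge0.
- by move=> k; rewrite ltW // mulr_gt0.
- by rewrite mulr_ge0 // addr_ge0 // mulr_ge0.
- by move=> k; rewrite mulr_ge0 // ltW.
- by [].
- move=> w.
  exact: (@sum_gradg R H ip hip f g gradf gradg Lf Lg Gf finf gmin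
    (objective_gradient hf) (gradient_lipschitz hf) (objective_gradient hg)
    (gradient_lipschitz hg) gradf_bounded f_ge g_ge Lg_gt0 ce cb cr n p
    ce_gt0 cb_gt0 cr_gt0 p_ge1 p3_le p_mono eta_Lf eta_Lg beta_le1
    (x^~ w) (batchf ip gradF gradG eta beta rho Bf Bg x0 xi zeta ^~ w)
    (batchg ip gradF gradG eta beta rho Bf Bg x0 xi zeta ^~ w) (fun k => erefl _) K).
rewrite lee_fin wt_sum.
set S := \sum_(0 <= k < K) (n k)^-1.
have hs : \sum_(0 <= k < K) (16 * eta k * (sigmaf2 / (Bf k)%:R) +
     (4 / Lg + 2 * (ce * cb)) * (sigmag2 / (Bg k)%:R)) <=
    (16 * ce * CF * sigmaf2 + (4 / Lg + 2 * (ce * cb)) * CG * sigmag2) * S.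
  rewrite mulr_sumr; apply: ler_sum => k _.
  have := ler_wpM2l (mulr_ge0 b0 sigmag2_ge0) (Bg_n k).
  have := ler_wpM2l (mulr_ge0 (ler0n R 16) sigmaf2_ge0) (eta_Bf k); lra.
apply: ler_ratio => //.
have c1 : 0 <= 16 * ce * CF * sigmaf2 by rewrite !mulr_ge0 // ltW.
have c2 : 0 <= (4 / Lg + 2 * (ce * cb)) * CG * sigmag2 by rewrite !mulr_ge0 // ltW.
move: hs (mulr_ge0 L0_ge0 S0) dr_ge0; rewrite -/S; lra.
Qed.

Lemma direction_rate (w : nat -> R) :
  (forall k, 0 <= w k) -> (forall k, w k.+1 <= w k) ->
  (forall k, (k < K)%N -> p k ^+ 4 / n k <= w k) ->
  ('E_P[fun o => (`|direction ip (beta (N o)) (rho (N o))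
      (gradf (x (N o) o)) (gradg (x (N o) o))| ^+ 2)%R] <=
   (direction_constant * (p 0%N ^+ 3 / n 0%N + \sum_(0 <= k < K) p k ^+ 4 / n k ^+ 2
      + w 0%N + \sum_(0 <= k < K) w k / n k) / V)%:E)%E.
Proof.
move=> w0 wS pw.
pose h k y := `|direction ip (beta k) (rho k) (gradf y) (gradg y)| ^+ 2.
have ch k : seq_continuous (h k : H -> R^o).
  move=> y z yz; pose d y := direction ip (beta k) (rho k) (gradf y) (gradg y).
  have cd : d (y n) @[n --> \oo] --> d z.
    have yf := lipschitz_seq_continuous (gradient_lipschitz hf) yz.
    have yg := lipschitz_seq_continuous (gradient_lipschitz hg) yz.
    by have := @seq_continuous2_direction R H ip hip (beta k) (rho k) (rho_gt0 k)
      _ _ _ _ yf yg.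
  by apply: (@cvgM _ _ _ _ (fun n => `|d (y n)|) (fun n => `|d (y n)|)); exact: cvg_norm.
have W0 : 0 < \sum_(0 <= l < K) eta l * beta l by rewrite wt_sum mulr_gt0.
set S1 := \sum_(0 <= k < K) p k ^+ 4 / n k ^+ 2.
set S3 := \sum_(0 <= k < K) w k / n k.
have f0 : 0 <= f x0 - finf by rewrite subr_ge0.
have S1_ge0 : 0 <= S1.
  by apply: sumr_ge0 => k _; rewrite divr_ge0 ?exprn_ge0 // ltW.
have S3_ge0 : 0 <= S3 by apply: sumr_ge0 => k _; rewrite divr_ge0 // ltW.
have cb0 : 0 <= 4 * cb * (f x0 - finf) by rewrite !mulr_ge0 // ltW.
have c1 : 0 <= Gf ^+ 2 * (ce * cb) ^+ 2 by rewrite mulr_ge0 // sqr_ge0.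
have cL : 0 <= 4 * cpl / Lg by rewrite divr_ge0 ?mulr_ge0 // ltW.
apply: le_trans (@random_iterate_bound _ _ ip hip _ _ _ _ _ _ P Pf Pg _ _ _ _
  _ _ _ _ _ _ _ _ hf hg eta beta rho Bf Bg x0 rho_gt0 (fun k => eta k * beta k) K
  xi zeta N samp h ch _ _ W0
  (4 * cb * (f x0 - finf) * (p 0%N ^+ 3 / n 0%N) + Gf ^+ 2 * (ce * cb) ^+ 2 * S1
   + 8 * cpl * (w 0%N * L0 + dr * S3))
  (fun k => 24 * (eta k * beta k) + 16 * cpl * (w k * eta k))
  (fun k => eta k * beta k * (72 * beta k ^+ 2 + 8 * Gf ^+ 2 / rho k)
         + 4 * cpl / Lg * w k) _ _ _ Bf_gt0 Bg_gt0 _) _.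
- by move=> k y; rewrite exprn_ge0.
- by move=> k; rewrite ltW // mulr_gt0.
- have h1 := mulr_ge0 cb0 (s_ge0 0%N); have h2 := mulr_ge0 c1 S1_ge0.
  have h3 : 0 <= w 0%N * L0 + dr * S3 by rewrite addr_ge0 // mulr_ge0.
  apply: addr_ge0; first exact: addr_ge0.
  by apply: mulr_ge0 => //; apply: mulr_ge0.
- move=> k; have e0 := ltW (eta_gt0 k); have b0 := ltW (beta_gt0 k).
  have h1 := mulr_ge0 e0 b0; have h2 := mulr_ge0 (w0 k) e0.
  by apply: addr_ge0; apply: mulr_ge0 => //; apply: mulr_ge0.
- move=> k; have e0 := ltW (eta_gt0 k); have b0 := ltW (beta_gt0 k).
  apply: addr_ge0; last exact: (mulr_ge0 cL (w0 k)).
  apply: mulr_ge0; first exact: (mulr_ge0 e0 b0).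
  by apply: addr_ge0; [rewrite mulr_ge0 ?sqr_ge0|
    rewrite divr_ge0 ?(ltW (rho_gt0 k)) // mulr_ge0 ?sqr_ge0].
- move=> o.
  exact: (@sum_direction R H ip hip f g gradf gradg Lf Lg Gf finf gmin
    (objective_gradient hf) (gradient_lipschitz hf) (objective_gradient hg)
    (gradient_lipschitz hg) gradf_bounded f_ge g_ge Lg_gt0 ce cb cr n p
    ce_gt0 cb_gt0 cr_gt0 p_ge1 p3_le p_mono beta_mono eta_Lf eta_Lg beta_le1
    (x^~ o) (batchf ip gradF gradG eta beta rho Bf Bg x0 xi zeta ^~ o)
    (batchg ip gradF gradG eta beta rho Bf Bg x0 xi zeta ^~ o) (fun k => erefl _)
    w K w0 wS pw).
rewrite lee_fin wt_sum.
have hs : \sum_(0 <= k < K)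
     ((24 * (eta k * beta k) + 16 * cpl * (w k * eta k)) * (sigmaf2 / (Bf k)%:R) +
      (eta k * beta k * (72 * beta k ^+ 2 + 8 * Gf ^+ 2 / rho k) + 4 * cpl / Lg * w k)
       * (sigmag2 / (Bg k)%:R)) <=
  (sigmaf2 * CF * (24 * (ce * cb)) + sigmag2 * CG *
    (ce * cb * (72 * cb ^+ 2 + 8 * Gf ^+ 2 / cr ^+ 2))) * S1
  + (sigmaf2 * CF * (16 * cpl * ce) + sigmag2 * CG * (4 * cpl / Lg)) * S3.
  rewrite !mulr_sumr -big_split /=; apply: ler_sum => k _.
  have := ler_wpM2l (mulr_ge0 (ler0n R 24) sigmaf2_ge0) (ebb k).
  have := ler_wpM2l sigmag2_ge0 (ebg k).
  have := ler_wpM2l (mulr_ge0 (mulr_ge0 cL (w0 k)) sigmag2_ge0) (Bg_n k).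
  have := ler_wpM2l (mulr_ge0 (mulr_ge0 (mulr_ge0 (ler0n R 16) cpl_ge0) (w0 k))
    sigmaf2_ge0) (eta_Bf k).
  lra.
apply: ler_ratio => //.
have z0 := s_ge0 0%N.
set c2 := Gf ^+ 2 * (ce * cb) ^+ 2 in c1 *.
have c3 : 0 <= 8 * cpl * L0 by rewrite !mulr_ge0.
have c4 : 0 <= 8 * cpl * dr by rewrite !mulr_ge0.
have c5 : 0 <= sigmaf2 * CF * (24 * (ce * cb)) by rewrite !mulr_ge0 // ltW.
have c6 : 0 <= sigmaf2 * CF * (16 * cpl * ce) by rewrite !mulr_ge0 // ltW.
have c7 : 0 <= sigmag2 * CG * (ce * cb * (72 * cb ^+ 2 + 8 * Gf ^+ 2 / cr ^+ 2)).
  have h1 : 0 <= 72 * cb ^+ 2 by rewrite mulr_ge0 ?sqr_ge0 //.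
  have h2 : 0 <= 8 * Gf ^+ 2 / cr ^+ 2.
    by apply: divr_ge0; [apply: mulr_ge0 => //; exact: sqr_ge0|exact: sqr_ge0].
  have h3 := mulr_ge0 (ltW cecb_gt0) (addr_ge0 h1 h2).
  exact: (mulr_ge0 (mulr_ge0 sigmag2_ge0 (ltW CG_gt0)) h3).
have c8 := mulr_ge0 (mulr_ge0 sigmag2_ge0 (ltW CG_gt0)) cL.
(* A sum of products of nonnegative numbers is at most the product of the sums, so a single constant
   can be factored out of the four terms. *)
have dist a1 a2 a3 a4 b1 b2 b3 b4 : 0 <= a1 -> 0 <= a2 -> 0 <= a3 -> 0 <= a4 ->
    0 <= b1 -> 0 <= b2 -> 0 <= b3 -> 0 <= b4 ->
    a1 * b1 + a2 * b2 + a3 * b3 + a4 * b4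
      <= (a1 + a2 + a3 + a4) * (b1 + b2 + b3 + b4) :> R.
  move=> A1 A2 A3 A4 B1 B2 B3 B4.
  have P12 := mulr_ge0 A1 B2; have P13 := mulr_ge0 A1 B3; have P14 := mulr_ge0 A1 B4.
  have P21 := mulr_ge0 A2 B1; have P23 := mulr_ge0 A2 B3; have P24 := mulr_ge0 A2 B4.
  have P31 := mulr_ge0 A3 B1; have P32 := mulr_ge0 A3 B2; have P34 := mulr_ge0 A3 B4.
  have P41 := mulr_ge0 A4 B1; have P42 := mulr_ge0 A4 B2; have P43 := mulr_ge0 A4 B3.
  lra.
have := dist _ _ _ _ _ _ _ _ cb0 (addr_ge0 c1 (addr_ge0 c5 c7)) c3
  (addr_ge0 c4 (addr_ge0 c6 c8)) z0 S1_ge0 (w0 0%N) S3_ge0.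
move: hs; lra.
Qed.

End Rates.

(** * Real powers and bounds for sums of powers *)

Section PowerSums.
Variable R : realType.
Implicit Types (x y a r s e : R).

Lemma powRB_pos x r s : 0 < x -> x `^ (r - s) = x `^ r / x `^ s.
Proof. by move=> x0; rewrite powRB // (gt_eqF x0) implybT. Qed.

Lemma powR_quotient a x (i j : nat) : 0 < x ->
  (x `^ a) ^+ i / x ^+ j = x `^ (a * i%:R - j%:R).
Proof.
move=> x0; rewrite powRB_pos // powRrM !powR_mulrn ?powR_ge0 //.
exact: ltW.
Qed.

Lemma powR_nonincreasing s x y : s <= 0 -> 0 < x -> x <= y -> y `^ s <= x `^ s.
Proof.
move=> s0 x0 xy; have y0 := lt_le_trans x0 xy.
have E z : z `^ s = (z `^ (- s))^-1 by rewrite -powRN opprK.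
rewrite !E lef_pV2 ?posrE ?powR_gt0 //.
have s0' : 0 <= - s by rewrite oppr_ge0.
by apply: (ge0_ler_powR s0' _ _ xy); rewrite nnegrE ltW.
Qed.

Lemma powR_nondecreasing s x y : 0 <= s -> 0 < x -> x <= y -> x `^ s <= y `^ s.
Proof.
move=> s0 x0 xy; have y0 := lt_le_trans x0 xy.
by apply: (ge0_ler_powR s0 _ _ xy); rewrite nnegrE ltW.
Qed.

Lemma powR_ge1 s x : 0 <= s -> 1 <= x -> 1 <= x `^ s.
Proof. by move=> s0 x1; rewrite -(powRr0 x) ler_powR. Qed.

(** From ln (1 + t) <= t at t = - 1/(k + 1), where k > 0 keeps 1 + t positive. *)
Lemma inv_succ_le_ln (k : nat) : (0 < k)%N ->
  (k.+1%:R : R)^-1 <= ln k.+1%:R - ln k%:R.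
Proof.
move=> k0; have kp : 0 < k%:R :> R by rewrite ltr0n.
have kp1 : 0 < k.+1%:R :> R by rewrite ltr0n.
rewrite -ln_div ?posrE // -[_ / _]invf_div lnV ?posrE ?divr_gt0 // lerNr.
rewrite (_ : k%:R / k.+1%:R = 1 + - (k.+1%:R)^-1); last first.
  by rewrite -(natr1 k) in kp1 *; field; rewrite gt_eqF.
by apply: le_ln1Dx; rewrite ltrN2 invf_lt1 // ltr1n.
Qed.

Lemma sum_inv_le_ln (K : nat) : (0 < K)%N ->
  \sum_(0 <= k < K) (k.+1%:R : R)^-1 <= 1 + ln K%:R.
Proof.
case: K => // K _; elim: K => [|K IH].
  by rewrite big_nat1 invr1 ln1 addr0.
rewrite big_nat_recr //=.
apply: le_trans (lerD IH (@inv_succ_le_ln K.+1 isT)) _.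
by rewrite -addrA lerD2l addrC subrK.
Qed.

(** A telescoping majorant that replaces comparison with an integral: k^(-e) is (k + 1)^(-e) times
    exp (e (ln (k + 1) - ln k)), and exp s >= 1 + s. *)
Lemma powR_succ_le e (k : nat) : 0 < e -> (0 < k)%N ->
  e * k.+1%:R `^ (- e - 1) <= k%:R `^ (- e) - k.+1%:R `^ (- e).
Proof.
move=> e0 k0; have kp : 0 < k%:R :> R by rewrite ltr0n.
have kp1 : 0 < k.+1%:R :> R by rewrite ltr0n.
rewrite powRB_pos // powRr1 ?(ltW kp1) // lerBrDr.
have -> : k%:R `^ (- e) = k.+1%:R `^ (- e) * expR (e * (ln k.+1%:R - ln k%:R)).
  rewrite /powR !gt_eqF //= -expRD; congr expR; ring.
have h : 1 + e * (k.+1%:R)^-1 <= expR (e * (ln k.+1%:R - ln k%:R)).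
  apply: le_trans (expR_ge1Dx _); rewrite lerD2l ler_wpM2l ?(ltW e0) //.
  exact: inv_succ_le_ln.
apply: le_trans (ler_wpM2l (powR_ge0 _ _) h).
by rewrite mulrDr mulr1 addrC mulrCA.
Qed.

Lemma sum_powR_bounded e (K : nat) : 0 < e ->
  \sum_(0 <= k < K) k.+1%:R `^ (- e - 1) <= 1 + e^-1.
Proof.
move=> e0; case: K => [|K]; first by rewrite big_geq // addr_ge0 // invr_ge0 ltW.
(* The subtracted power is the remainder that makes the induction telescope through
   [powR_succ_le]. *)
suff : \sum_(0 <= k < K.+1) k.+1%:R `^ (- e - 1) <=
    1 + e^-1 * (1 - K.+1%:R `^ (- e)).
  move=> h; apply: le_trans h _; rewrite lerD2l ler_piMr //.
    by rewrite invr_ge0 ltW.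
elim: K => [|K IH]; first by rewrite big_nat1 !powR1 subrr mulr0 addr0.
rewrite big_nat_recr //=.
have ie : 0 <= e^-1 by rewrite invr_ge0 ltW.
have := ler_wpM2l ie (@powR_succ_le e K.+1 e0 isT).
rewrite mulrA mulVf ?gt_eqF // mul1r => h.
apply: le_trans (lerD IH h) _.
by rewrite -addrA lerD2l -mulrDr addrA subrK.
Qed.

End PowerSums.

(** * Parameter schedules in terms of the clock and its power *)

Section ClockPowers.
Variables (R : realType) (a : R).
Hypothesis ha : 0 < a < 1 / 3.

Let a_gt0 : 0 < a. Proof. by case/andP: ha. Qed.
Let a_lt : a < 1 / 3. Proof. by case/andP: ha. Qed.

(** The exponent 3a stays below 1. Here and in [clock_cube_quotient], a < 1/3 makes p^3/n, hence
    beta, bounded and nonincreasing. *)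
Lemma clock_cube_le (x : R) : 1 <= x -> (x `^ a) ^+ 3 <= x.
Proof.
move=> x1; rewrite -powR_mulrn ?powR_ge0 // -powRrM.
by apply: ler1_powR => //; move: a_lt; lra.
Qed.

Lemma clock_cube_quotient (x y : R) : 0 < x -> x <= y ->
  (y `^ a) ^+ 3 / y <= (x `^ a) ^+ 3 / x.
Proof.
move=> x0 xy; have y0 := lt_le_trans x0 xy.
have := powR_quotient a 3 1 x0; have := powR_quotient a 3 1 y0.
rewrite !expr1 => -> ->; apply: powR_nonincreasing => //; move: a_lt; lra.
Qed.

Lemma normalized_eta (c x : R) : c * x `^ (- a) = c / x `^ a.
Proof. by rewrite powRN. Qed.

Lemma normalized_beta (c1 c x p : R) : 0 < c1 -> 0 < x -> 0 < p ->
  c * ((c1 / p) ^- 3 * x^-1) = c / c1 ^+ 3 * (p ^+ 3 / x).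
Proof. by move=> c0 x0 p0; field; rewrite !gt_eqF. Qed.

(** The square exhibits r = sqrt rho, in which the one-step estimates are stated. *)
Lemma normalized_rho (c1 c x p : R) : 0 < c1 -> 0 < c -> 0 < x -> 0 < p ->
  c * ((c1 / p) ^- 2 * x ^- 2) = (Num.sqrt c / c1 * (p / x)) ^+ 2.
Proof.
move=> c10 c0 x0 p0; rewrite !exprMn sqr_sqrtr ?(ltW c0) //.
by field; rewrite !gt_eqF.
Qed.

Lemma normalized_Bf (c1 c x p B : R) : 0 < c1 -> 0 < c -> 0 < x -> 0 < p ->
  c * ((c1 / p) ^+ 4 * x ^+ 2) <= B ->
  B^-1 <= (c * c1 ^+ 4)^-1 * (p ^+ 4 / x ^+ 2).
Proof.
move=> c10 c0 x0 p0 cB.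
have l0 : 0 < c * ((c1 / p) ^+ 4 * x ^+ 2)
  by apply: mulr_gt0 => //; apply: mulr_gt0; apply: exprn_gt0 => //; exact: divr_gt0.
rewrite (_ : (c * c1 ^+ 4)^-1 * _ = (c * ((c1 / p) ^+ 4 * x ^+ 2))^-1); last first.
  by field; rewrite !gt_eqF.
by rewrite lef_pV2 ?posrE // (lt_le_trans l0).
Qed.

Lemma normalized_Bg (c1 c x p B : R) : 0 < c1 -> 0 < c -> 0 < x -> 0 < p ->
  c * ((c1 / p) ^+ 6 * x ^+ 4) <= B ->
  B^-1 <= (c * c1 ^+ 6)^-1 * (p ^+ 6 / x ^+ 4).
Proof.
move=> c10 c0 x0 p0 cB.
have l0 : 0 < c * ((c1 / p) ^+ 6 * x ^+ 4)
  by apply: mulr_gt0 => //; apply: mulr_gt0; apply: exprn_gt0 => //; exact: divr_gt0.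
rewrite (_ : (c * c1 ^+ 6)^-1 * _ = (c * ((c1 / p) ^+ 6 * x ^+ 4))^-1); last first.
  by field; rewrite !gt_eqF.
by rewrite lef_pV2 ?posrE // (lt_le_trans l0).
Qed.

Lemma stepsize_bounds (Lf Lg e : R) : 0 < Lf -> 0 < Lg -> 0 < e ->
  e < (2 * Lf + 4 * Lg)^-1 -> e * Lf <= 1 / 2 /\ 4 * Lg * e <= 1.
Proof.
move=> Lf0 Lg0 e0.
have D0 : 0 < 2 * Lf + 4 * Lg by rewrite addr_gt0 // mulr_gt0.
rewrite -(ltr_pM2r D0) mulVf ?gt_eqF // => h.
have := mulr_gt0 e0 Lf0; have := mulr_gt0 e0 Lg0; split; lra.
Qed.

(** The exponent 2a - 1 is negative, so each of the [K] terms is at least K^(2a - 1). *)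
Lemma sum_clock_weights (K : nat) : (0 < K)%N ->
  K%:R `^ (2 * a) <= \sum_(0 <= k < K) (k.+1%:R `^ a) ^+ 2 / k.+1%:R.
Proof.
move=> K0; have Kp : 0 < K%:R :> R by rewrite ltr0n.
have h : \sum_(0 <= k < K) K%:R `^ (a * 2 - 1) <=
    \sum_(0 <= k < K) (k.+1%:R `^ a) ^+ 2 / k.+1%:R.
  apply: ler_sum_nat => k /andP[_ kK]; have := @powR_quotient R a k.+1%:R 2 1.
  rewrite expr1 => ->; last by rewrite ltr0n.
  apply: powR_nonincreasing; rewrite ?ltr0n ?ler_nat //; move: a_lt; lra.
apply: le_trans h; rewrite sumr_const_nat subn0 powRB_pos //.
rewrite powRr1 ?(ltW Kp) // mulrC -[leRHS]mulr_natr divfK ?gt_eqF //.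
Qed.

End ClockPowers.

Theorem mainTheorem1 (R : realType) (H : completeNormedModType R)
    (ip : {dot H for idfun}) (hip : hilbert_norm ip)
    (df dg : measure_display) (Sf : measurableType df) (Sg : measurableType dg)
    (Pf : probability Sf R) (Pg : probability Sg R)
    (F : Sf -> H -> R) (gradF : Sf -> H -> H) (f : H -> R) (gradf : H -> H)
    (G : Sg -> H -> R) (gradG : Sg -> H -> H) (g : H -> R) (gradg : H -> H)
    (Lf Lg Gf sigmaf2 sigmag2 : R)
    (Lf_gt0 : 0 < Lf) (Lg_gt0 : 0 < Lg) (Gf_gt0 : 0 < Gf)
    (sigmaf2_ge0 : 0 <= sigmaf2) (sigmag2_ge0 : 0 <= sigmag2)
    (hf : stochastic_objective ip Pf F gradF f gradf Lf sigmaf2)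
    (hg : stochastic_objective ip Pg G gradG g gradg Lg sigmag2)
    (gradf_bounded : forall x, `|gradf x| <= Gf)
    (f_lower_bounded : has_lbound (range f))
    (argmin_g : exists xmin, forall x, g xmin <= g x)
    (x0 : H) (a : R) (ha : 0 < a < 1 / 3) :
  (* horizon-dependent parameters: eta, beta, rho, Bf, Bg are functions of K *)
  (forall (eta beta rho : nat -> R) (Bf Bg : nat -> nat),
     let D := [set K | (1 <= K)%N] in
     propto D eta (fun K => K%:R `^ (- a)) ->
     (forall K, D K -> 0 < eta K < (2 * Lf + 4 * Lg)^-1) ->
     propto D beta (fun K => eta K ^- 3 * K%:R^-1) ->
     (forall K, D K -> 0 < beta K < 1) ->
     propto D rho (fun K => eta K ^- 2 * K%:R ^- 2) ->
     batch_propto D Bf (fun K => eta K ^+ 4 * K%:R ^+ 2) ->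
     batch_propto D Bg (fun K => eta K ^+ 6 * K%:R ^+ 4) ->
     exists C : R, forall K : nat, (1 <= K)%N ->
       forall (dO : measure_display) (Omega : measurableType dO)
         (P : probability Omega R)
         (xi : nat -> nat -> {mfun Omega >-> Sf})
         (zeta : nat -> nat -> {mfun Omega >-> Sg})
         (N : {mfun Omega >-> nat}),
       sampling P Pf Pg (fun=> Bf K) (fun=> Bg K) (fun=> eta K * beta K) K
         xi zeta N ->
       let x k w := sdbgd ip gradF gradG (fun=> eta K) (fun=> beta K)
         (fun=> rho K) (fun=> Bf K) (fun=> Bg K) x0
         (fun l i => xi l i w) (fun l j => zeta l j w) k in
       let d k w := direction ip (beta K) (rho K)
         (gradf (x k w)) (gradg (x k w)) in
       ('E_P[fun w => (`|d (N w) w| ^+ 2)%R]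
          <= (C * K%:R `^ (- 1 + 2 * a))%:E)%E /\
       ('E_P[fun w => (`|gradg (x (N w) w)| ^+ 2)%R]
          <= (C * K%:R `^ (- 2 * a))%:E)%E)
  /\
  (* anytime parameters: eta, beta, rho, Bf, Bg are functions of k *)
  (forall (eta beta rho : nat -> R) (Bf Bg : nat -> nat),
     propto setT eta (fun k => k.+1%:R `^ (- a)) ->
     (forall k, 0 < eta k < (2 * Lf + 4 * Lg)^-1) ->
     propto setT beta (fun k => eta k ^- 3 * k.+1%:R^-1) ->
     (forall k, 0 < beta k < 1) ->
     propto setT rho (fun k => eta k ^- 2 * k.+1%:R ^- 2) ->
     batch_propto setT Bf (fun k => eta k ^+ 4 * k.+1%:R ^+ 2) ->
     batch_propto setT Bg
       (fun k => Num.max (eta k ^- 2) (eta k ^+ 6 * k.+1%:R ^+ 4)) ->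
     exists C : R, forall K : nat, (2 <= K)%N ->
       forall (dO : measure_display) (Omega : measurableType dO)
         (P : probability Omega R)
         (xi : nat -> nat -> {mfun Omega >-> Sf})
         (zeta : nat -> nat -> {mfun Omega >-> Sg})
         (N : {mfun Omega >-> nat}),
       sampling P Pf Pg Bf Bg (fun k => eta k * beta k) K xi zeta N ->
       let x k w := sdbgd ip gradF gradG eta beta rho Bf Bg x0
         (fun l i => xi l i w) (fun l j => zeta l j w) k in
       let d k w := direction ip (beta k) (rho k)
         (gradf (x k w)) (gradg (x k w)) in
       [/\ a < 1 / 4 ->
             ('E_P[fun w => (`|d (N w) w| ^+ 2)%R]
                <= (C * K%:R `^ (- 2 * a))%:E)%E,
           1 / 4 <= a ->
             ('E_P[fun w => (`|d (N w) w| ^+ 2)%R]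
                <= (C * K%:R `^ (2 * a - 1) * ln K%:R)%:E)%E &
           ('E_P[fun w => (`|gradg (x (N w) w)| ^+ 2)%R]
              <= (C * K%:R `^ (- 2 * a) * ln K%:R)%:E)%E]).
Proof.
have [a0 a3] := andP ha.
have [m mP] := f_lower_bounded.
have f_ge x : m <= f x by apply: mP; exists x.
have [xmin g_ge] := argmin_g.
have pow_ge0 : 0 <= a by exact: ltW.
split.
  move=> eta beta rho Bf Bg D [c1 c1_gt0 etaE] eta_rng [c2 c2_gt0 betaE] beta_rng.
  move=> [c3 c3_gt0 rhoE] [cF [CF' [cF0 _ BfP]]] [cG [CG' [cG0 _ BgP]]].
  pose cb := c2 / c1 ^+ 3; pose cr := Num.sqrt c3 / c1.
  pose CF := (cF * c1 ^+ 4)^-1; pose CG := (cG * c1 ^+ 6)^-1.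
  have cb0 : 0 < cb by rewrite divr_gt0 ?exprn_gt0.
  have cr0 : 0 < cr by rewrite divr_gt0 ?sqrtr_gt0.
  have CF0 : 0 < CF by rewrite invr_gt0 mulr_gt0 ?exprn_gt0.
  have CG0 : 0 < CG by rewrite invr_gt0 mulr_gt0 ?exprn_gt0.
  pose Cg := gradg_constant f g Lg Gf sigmaf2 sigmag2 m (g xmin) x0 c1 cb cr CF CG.
  pose Cd := direction_constant f g Lg Gf sigmaf2 sigmag2 m (g xmin) x0 c1 cb cr CF CG.
  have Cg0 : 0 <= Cg by exact: gradg_constant_ge0.
  have Cd0 : 0 <= Cd by exact: direction_constant_ge0.
  (* The 2 is 1 plus the sum of K copies of 1/K; the 4 counts the terms of [direction_rate], each at
     most [T] below. *)
  exists (2 * Cg + 4 * Cd) => K K1 dO Omega P xi zeta N samp x d.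
  have Kp : 0 < K%:R :> R by rewrite ltr0n.
  have K1' : 1 <= K%:R :> R by rewrite ler1n.
  pose n (_ : nat) : R := K%:R; pose p (_ : nat) : R := K%:R `^ a.
  have p1 k : 1 <= p k by exact: powR_ge1.
  have p0 k : 0 < p k by exact: lt_le_trans (p1 k).
  have eE : eta K = c1 / p 0%N by rewrite etaE // normalized_eta.
  have bE : beta K = cb * (p 0%N ^+ 3 / n 0%N) by rewrite betaE // eE normalized_beta.
  have rE : rho K = (cr * (p 0%N / n 0%N)) ^+ 2 by rewrite rhoE // eE normalized_rho.
  have [B1 B2] := BfP K K1; have [B3 B4] := BgP K K1.
  have [e1 e2] : eta K * Lf <= 1 / 2 /\ 4 * Lg * eta K <= 1.
    by have /andP[? ?] := eta_rng K K1; exact: stepsize_bounds.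
  have b1 : beta K <= 1 by have /andP[_ /ltW] := beta_rng K K1.
  have BfE : (Bf K)%:R^-1 <= CF * (p 0%N ^+ 4 / n 0%N ^+ 2).
    by apply: normalized_Bf => //; rewrite -eE; case/andP: B2.
  have BgE : (Bg K)%:R^-1 <= CG * (p 0%N ^+ 6 / n 0%N ^+ 4).
    by apply: normalized_Bg => //; rewrite -eE; case/andP: B4.
  move: e1 e2 b1 samp @x @d; rewrite eE bE rE => e1 e2 b1 samp x d.
  have p3 k : p k ^+ 3 <= n k by exact: clock_cube_le.
  have Hg := gradg_rate hip Lg_gt0 Gf_gt0 sigmaf2_ge0 sigmag2_ge0 hf hg
    gradf_bounded f_ge g_ge x0 c1_gt0 cb0 cr0 CF0 CG0 p1 p3 (fun=> lexx _)
    (fun=> e1) (fun=> e2) (fun=> b1) (fun=> B1) (fun=> B3) (fun=> BfE) (fun=> BgE)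
    K1 samp.
  have Hd := direction_rate hip Lg_gt0 Gf_gt0 sigmaf2_ge0 sigmag2_ge0 hf hg
    gradf_bounded f_ge g_ge x0 c1_gt0 cb0 cr0 CF0 CG0 p1 p3 (fun=> lexx _)
    (fun=> lexx _)
    (fun=> e1) (fun=> e2) (fun=> b1) (fun=> B1) (fun=> B3) (fun=> BfE) (fun=> BgE)
    K1 samp (w := fun k => p k ^+ 4 / n k) (fun k => divr_ge0 (exprn_ge0 4 (ltW (p0 k)))
    (ltW Kp)) (fun=> lexx _) (fun _ _ => lexx _).
  have sumK (c : R) : \sum_(0 <= k < K) c = c * K%:R.
    by rewrite sumr_const_nat subn0 mulr_natr.
  have p2E : p 0%N ^+ 2 = K%:R `^ (2 * a).
    by rewrite /p -powR_mulrn ?powR_ge0 // -powRrM mulrC.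
  have K2a : 0 <= K%:R `^ (2 * a) := powR_ge0 _ _.
  have q0 : K%:R != 0 :> R by rewrite gt_eqF.
  have q1 : p 0%N != 0 by rewrite gt_eqF.
  have SV : \sum_(0 <= k < K) p k ^+ 2 / n k = p 0%N ^+ 2.
    by transitivity (p 0%N ^+ 2 / n 0%N * K%:R); [exact: (sumK (p 0%N ^+ 2 / n 0%N))|rewrite divfK].
  have p2_gt0 : 0 < p 0%N ^+ 2 by rewrite exprn_gt0.
  split; last first.
    apply: le_trans Hg _; rewrite lee_fin -/Cg SV mulNr powRN -p2E.
    have -> : \sum_(0 <= k < K) (n k)^-1 = 1.
      by transitivity ((n 0%N)^-1 * K%:R); [exact: (sumK (n 0%N)^-1)|rewrite mulVf].
    by rewrite ler_wpM2r ?invr_ge0 ?(ltW p2_gt0) //; move: Cg0 Cd0; lra.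
  apply: le_trans Hd _; rewrite lee_fin -/Cd SV.
  rewrite -[- 1 + _]addrC powRB_pos // powRr1 ?(ltW Kp) // -p2E.
  (* The target K^(2a - 1) equals [T] divided by the total weight p^2, and p >= 1 puts the initial
     term p^3/n below [T]. *)
  pose T := p 0%N ^+ 4 / n 0%N.
  have T0 : 0 <= T by rewrite divr_ge0 ?exprn_ge0 ?(ltW (p0 _)) ?(ltW Kp).
  have -> : p 0%N ^+ 2 / K%:R = T / p 0%N ^+ 2.
    by rewrite /T /n; field; rewrite q0 q1.
  have p3T : p 0%N ^+ 3 / n 0%N <= T.
    by rewrite ler_wpM2r ?invr_ge0 ?(ltW Kp) // ler_weXn2l.
  have -> : \sum_(0 <= k < K) p k ^+ 4 / n k ^+ 2 = T.
    transitivity (p 0%N ^+ 4 / n 0%N ^+ 2 * K%:R).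
      exact: (sumK (p 0%N ^+ 4 / n 0%N ^+ 2)).
    by rewrite /T /n; field.
  have -> : \sum_(0 <= k < K) p k ^+ 4 / n k / n k = T.
    by transitivity (T / n 0%N * K%:R); [exact: (sumK (T / n 0%N))|rewrite divfK].
  rewrite -/T mulrA ler_wpM2r ?invr_ge0 ?(ltW p2_gt0) //.
  have h1 : Cd * (p 0%N ^+ 3 / n 0%N + T + T + T) <= Cd * (4 * T).
    by rewrite ler_wpM2l //; lra.
  by have := mulr_ge0 Cg0 T0; lra.
move=> eta beta rho Bf Bg [c1 c1_gt0 etaE] eta_rng [c2 c2_gt0 betaE] beta_rng.
move=> [c3 c3_gt0 rhoE] [cF [CF' [cF0 _ BfP]]] [cG [CG' [cG0 _ BgP]]].
pose cb := c2 / c1 ^+ 3; pose cr := Num.sqrt c3 / c1.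
pose CF := (cF * c1 ^+ 4)^-1; pose CG := (cG * c1 ^+ 6)^-1.
have cb0 : 0 < cb by rewrite divr_gt0 ?exprn_gt0.
have cr0 : 0 < cr by rewrite divr_gt0 ?sqrtr_gt0.
have CF0 : 0 < CF by rewrite invr_gt0 mulr_gt0 ?exprn_gt0.
have CG0 : 0 < CG by rewrite invr_gt0 mulr_gt0 ?exprn_gt0.
pose Cg := gradg_constant f g Lg Gf sigmaf2 sigmag2 m (g xmin) x0 c1 cb cr CF CG.
pose Cd := direction_constant f g Lg Gf sigmaf2 sigmag2 m (g xmin) x0 c1 cb cr CF CG.
have Cg0 : 0 <= Cg by exact: gradg_constant_ge0.
have Cd0 : 0 <= Cd by exact: direction_constant_ge0.
pose n (k : nat) : R := k.+1%:R; pose p (k : nat) : R := k.+1%:R `^ a.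
have n1 k : 1 <= n k by rewrite /n ler1n.
have n0 k : 0 < n k by rewrite /n ltr0n.
have p1 k : 1 <= p k by exact: (powR_ge1 pow_ge0 (n1 k)).
have p0 k : 0 < p k by exact: lt_le_trans (p1 k).
have eE : eta = fun k => c1 / p k.
  by apply/funext => k; rewrite etaE // normalized_eta.
have bE : beta = fun k => cb * (p k ^+ 3 / n k).
  by apply/funext => k; rewrite betaE // eE normalized_beta.
have rE : rho = fun k => (cr * (p k / n k)) ^+ 2.
  by apply/funext => k; rewrite rhoE // eE normalized_rho.
have e12 k : eta k * Lf <= 1 / 2 /\ 4 * Lg * eta k <= 1.
  by have /andP[? ?] := eta_rng k; exact: stepsize_bounds.
have b1 k : beta k <= 1 by have /andP[_ /ltW] := beta_rng k.
have Bf0 k : (0 < Bf k)%N by case: (BfP k I).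
have Bg0 k : (0 < Bg k)%N by case: (BgP k I).
have BfE k : (Bf k)%:R^-1 <= CF * (p k ^+ 4 / n k ^+ 2).
  have [_ /andP[h _]] := BfP k I; apply: normalized_Bf => //.
  by move: h; rewrite eE.
have BgE k : (Bg k)%:R^-1 <= CG * (p k ^+ 6 / n k ^+ 4).
  have [_ /andP[h _]] := BgP k I; apply: normalized_Bg => //.
  apply: le_trans h; rewrite eE ler_wpM2l ?(ltW cG0) //.
  by rewrite le_max lexx orbT.
have p3 k : p k ^+ 3 <= n k := clock_cube_le ha (n1 k).
have pS k : p k <= p k.+1.
  by apply: (powR_nondecreasing pow_ge0 (n0 k)); rewrite ler_nat.
have bS k : p k.+1 ^+ 3 / n k.+1 <= p k ^+ 3 / n k.
  by apply: (clock_cube_quotient ha (n0 k)); rewrite ler_nat.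
have e1 k := (e12 k).1; have e2 k := (e12 k).2.
rewrite eE in e1 e2; rewrite bE in b1.
have p0E : p 0%N ^+ 3 / n 0%N = 1 by rewrite /p /n powR1 expr1n divr1.
pose l2 : R := (ln 2)^-1.
have ln2 : 0 < ln 2 :> R by rewrite ln_gt0 // ltr1n.
have l20 : 0 <= l2 by rewrite invr_ge0 ltW.
have pq k : p k ^+ 4 / n k = k.+1%:R `^ (4 * a - 1).
  by have := powR_quotient a 4 1 (n0 k); rewrite expr1 [a * _]mulrC.
(* One constant serves all three bounds, whose coefficients are the three summands. The factor [l2]
   absorbs constants into ln K, as K >= 2. The absolute value keeps the middle summand nonnegative
   for a > 1/4, and at a = 1/4 the inverse of 0 is 0 by convention. *)
exists (Cg * (2 * l2 + 1) + Cd * (2 * (2 + `|1 - 4 * a|^-1)) + Cd * (4 * l2 + 2)).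
move=> K K2 dO Omega P xi zeta N samp x d.
have K1 : (0 < K)%N := ltnW K2.
have Kp : 0 < K%:R :> R by rewrite ltr0n.
move: samp @x @d; rewrite eE bE rE => samp x d.
have Hg := gradg_rate hip Lg_gt0 Gf_gt0 sigmaf2_ge0 sigmag2_ge0 hf hg
  gradf_bounded f_ge g_ge x0 c1_gt0 cb0 cr0 CF0 CG0 p1 p3 pS
  e1 e2 b1 Bf0 Bg0 BfE BgE K1 samp.
have Hd := direction_rate hip Lg_gt0 Gf_gt0 sigmaf2_ge0 sigmag2_ge0 hf hg
  gradf_bounded f_ge g_ge x0 c1_gt0 cb0 cr0 CF0 CG0 p1 p3 pS bS
  e1 e2 b1 Bf0 Bg0 BfE BgE K1 samp.
rewrite -/Cg in Hg; rewrite -/Cd in Hd.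
set V := \sum_(0 <= k < K) p k ^+ 2 / n k in Hg Hd.
have V_ge : K%:R `^ (2 * a) <= V by exact: (sum_clock_weights ha K1).
have K2a_gt0 : 0 < K%:R `^ (2 * a) by exact: powR_gt0.
have iV : V^-1 <= K%:R `^ (- 2 * a).
  by rewrite mulNr powRN lef_pV2 ?posrE // (lt_le_trans K2a_gt0).
have S1 := sum_inv_le_ln R K1.
set S := \sum_(0 <= k < K) _ in S1.
have lnK : ln 2 <= ln K%:R :> R by rewrite ler_ln ?posrE // ler_nat.
have l2K : 1 <= l2 * ln K%:R.
  by rewrite mulrC ler_pdivlMr // mul1r.
have lnK0 : 0 <= ln K%:R :> R by apply: le_trans lnK; exact: ltW.
have Kna : 0 <= K%:R `^ (- 2 * a) := powR_ge0 _ _.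
have l24 : 0 <= 2 + `|1 - 4 * a|^-1 by rewrite addr_ge0 // invr_ge0.
have Cg1 : 0 <= Cg * (2 * l2 + 1).
  by apply: mulr_ge0 => //; apply: addr_ge0 => //; apply: mulr_ge0.
have Cd1 : 0 <= Cd * (2 * (2 + `|1 - 4 * a|^-1)).
  by apply: mulr_ge0 => //; apply: mulr_ge0.
have Cd2 : 0 <= Cd * (4 * l2 + 2).
  by apply: mulr_ge0 => //; apply: addr_ge0 => //; apply: mulr_ge0.
have ratio (X Y : R) : 0 <= X -> X <= Y -> X / V <= Y * K%:R `^ (- 2 * a).
  by move=> X0 XY; apply: ler_pM => //; rewrite invr_ge0 ltW // (lt_le_trans K2a_gt0).
have w_ge0 k : 0 <= p k ^+ 4 / n k by rewrite divr_ge0 ?exprn_ge0 ?(ltW (p0 k)) ?(ltW (n0 k)).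
have S1_ge0 : 0 <= \sum_(0 <= k < K) p k ^+ 4 / n k ^+ 2.
  by apply: sumr_ge0 => k _; rewrite divr_ge0 ?exprn_ge0 ?(ltW (p0 k)) ?(ltW (n0 k)).
have S1E : \sum_(0 <= k < K) p k ^+ 4 / n k ^+ 2 =
    \sum_(0 <= k < K) p k ^+ 4 / n k / n k.
  by apply: eq_bigr => k _; rewrite -mulrA -invfM.
split.
- move=> a4.
  (* Below 1/4 the exponent 4a - 1 is negative, so p^4/n can serve as its own weight. *)
  have wS k : p k.+1 ^+ 4 / n k.+1 <= p k ^+ 4 / n k.
    rewrite !pq; apply: powR_nonincreasing; rewrite ?ltr0n ?ler_nat //; lra.
  have := Hd (fun k => p k ^+ 4 / n k) w_ge0 wS (fun k _ => lexx _).
  move=> /le_trans; apply; rewrite lee_fin -S1E p0E.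
  have -> : p 0%N ^+ 4 / n 0%N = 1 by rewrite /p /n powR1 expr1n divr1.
  set S4 := \sum_(_ <= _ < _) _ in S1_ge0 *.
  have S4_le : S4 <= 1 + `|1 - 4 * a|^-1.
    have e0 : 0 < 1 - 4 * a by lra.
    rewrite (gtr0_norm e0); apply: le_trans (sum_powR_bounded K e0).
    apply: ler_sum => k _; rewrite powR_quotient //.
    by rewrite (_ : - (1 - 4 * a) - 1 = a * 4 - 2) //; ring.
  apply: ratio; first by rewrite mulr_ge0 // !addr_ge0.
  have h : Cd * (1 + S4 + 1 + S4) <= Cd * (2 * (2 + `|1 - 4 * a|^-1)).
    by rewrite ler_wpM2l //; lra.
  by lra.
(* From 1/4 on, p^4/n is nondecreasing; the constant [M] dominates it at all k < K. *)
- move=> a4; pose M := K%:R `^ (4 * a - 1).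
  have M0 : 0 <= M := powR_ge0 _ _.
  have M1 : 1 <= M by apply: powR_ge1; [lra|rewrite ler1n].
  have pM k : (k < K)%N -> p k ^+ 4 / n k <= M.
    move=> kK; rewrite pq; apply: powR_nondecreasing; rewrite ?ltr0n ?ler_nat //; lra.
  have := Hd (fun=> M) (fun=> M0) (fun=> lexx M) pM.
  move=> /le_trans; apply; rewrite lee_fin p0E.
  have -> : \sum_(0 <= k < K) M / n k = M * S by rewrite mulr_sumr.
  have S4_le : \sum_(0 <= k < K) p k ^+ 4 / n k ^+ 2 <= M * S.
    rewrite S1E mulr_sumr; apply: ler_sum_nat => k /andP[_ kK].
    by rewrite ler_wpM2r ?invr_ge0 ?(ltW (n0 k)) // pM.
  set S4 := \sum_(_ <= _ < _) _ in S1_ge0 S4_le *.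
  have S0 : 0 <= S by apply: sumr_ge0 => k _; rewrite invr_ge0.
  have MS0 := mulr_ge0 M0 S0.
  have -> : K%:R `^ (2 * a - 1) = M * K%:R `^ (- 2 * a).
    rewrite /M -powRD; last by rewrite (gt_eqF Kp) implybT.
    by congr (_ `^ _); ring.
  rewrite [leRHS]mulrAC [leRHS]mulrA; apply: ratio; first by rewrite mulr_ge0 // !addr_ge0.
  have Ml := ler_wpM2l M0 l2K.
  have MS := ler_wpM2l M0 S1.
  (* The left side is at most 2 M (1 + S), S <= 1 + ln K, and 1 <= l2 ln K. *)
  have h1 : 1 + S4 + M + M * S <= M * ((4 * l2 + 2) * ln K%:R) by lra.
  have h2 := ler_wpM2l Cd0 h1.
  have := mulr_ge0 (mulr_ge0 Cg1 M0) lnK0.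
  have := mulr_ge0 (mulr_ge0 Cd1 M0) lnK0; lra.
- move: Hg => /le_trans; apply; rewrite lee_fin [leRHS]mulrAC; apply: ratio.
    rewrite mulr_ge0 // addr_ge0 //; apply: sumr_ge0 => k _.
    by rewrite invr_ge0 ltW.
  have h1 : 1 + S <= (2 * l2 + 1) * ln K%:R by lra.
  have h2 := ler_wpM2l Cg0 h1.
  have := mulr_ge0 Cd1 lnK0; have := mulr_ge0 Cd2 lnK0.
  by rewrite -[\sum_(0 <= k < K) _]/S; lra.
Qed.
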